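(* Let $(A_1,\le_1)$ and $(A_2,\le_2)$ be quasi-hereditary $k$-algebras and let $M$ be an $A_2$-$A_1$-bimodule that is standardly filtered as a left $A_2$-module. Let $A$ be the triangular matrix ring $$A=\begin{pmatrix}A_2&M\\0&A_1\end{pmatrix}.$$ Suppose that $B_1$ and $B_2$ are exact Borel subalgebras of $A_1$ and $A_2$, with embeddings $\iota_1$ and $\iota_2$, respectively, and that $M\cong A_2\otimes_{B_2}N$ as an $A_2$-$B_1$-bimodule for some $B_2$-$B_1$-bimodule $N$. Then the triangular matrix ring $$B=\begin{pmatrix}B_2&N\\0&B_1\end{pmatrix}$$ is an exact Borel subalgebra of $A$ via the embedding $$\begin{pmatrix}\iota_2&f_N\\0&\iota_1\end{pmatrix}:B\to A,$$ where $f_N:N\to A_2\otimes_{B_2}N\cong M$, $x\mapsto 1\otimes x$.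
   Context: Conventions: $k$ is an algebraically closed field; all algebras are nonzero finite-dimensional associative unital $k$-algebras, subalgebras contain the unit, all vector spaces (in particular bimodules) are finite-dimensional, $k$ acts centrally on bimodules, and modules are left modules unless stated otherwise. $\operatorname{Sim}(A)$ is a set of representatives of the isomorphism classes of simple $A$-modules, and $P(L)$ is the projective cover of $L$. Quasi-hereditary algebras: for a partial order $\le_A$ on $\operatorname{Sim}(A)$ and $L\in\operatorname{Sim}(A)$, the standard module is $\Delta(L)=P(L)/\sum_{L'\not\le_A L,\ f\in\operatorname{Hom}_A(P(L'),P(L))}\operatorname{im}(f)$. A module is standardly filtered if it has a finite filtration whose subquotients are isomorphic to standard modules. The pair $(A,\le_A)$ is quasi-hereditary if for every $L\in \operatorname{Sim}(A)$ one has $\operatorname{End}_A(\Delta(L))\cong k$ and the kernel of $P(L)\to\Delta(L)$ has a finite filtration whose subquotients are isomorphic to standard modules $\Delta(L')$ with $L'>_A L$. It is called directed if it is quasi-hereditary and all standard modules are simple. Exact Borel subalgebra: a subalgebra $B$ of a quasi-hereditary algebra $(A,\le_A)$ is an exact Borel subalgebra if (1) $A$ is projective as a right $B$-module; (2) there is a bijection $\phi:\operatorname{Sim}(B)\to\operatorname{Sim}(A)$ with $A\otimes_B L\cong\Delta(\phi(L))$ for all $L\in\operatorname{Sim}(B)$; (3) $(B,\le_B)$ is directed, where $L\le_B L'$ if and only if $\phi(L)\le_A\phi(L')$. Order on the triangular matrix ring: via the projection $A\to A_1\times A_2$ one identifies $\operatorname{Sim}(A)$ with $\operatorname{Sim}(A_1)\sqcup\operatorname{Sim}(A_2)$.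 The order $\le_A$ restricts to $\le_1$ and $\le_2$ on the two parts, and every element of $\operatorname{Sim}(A_1)$ is strictly smaller than every element of $\operatorname{Sim}(A_2)$. It is known that $(A,\le_A)$ is quasi-hereditary when $M$ is standardly filtered as a left $A_2$-module. *)

(* Defs.v *)
From Corelib Require Relation_Definitions.
From HB Require Import structures.
From mathcomp Require Import all_boot all_order all_algebra all_field.

Set Implicit Arguments.
Unset Strict Implicit.
Unset Printing Implicit Defensive.

Import GRing.Theory.
Local Open Scope ring_scope.

(** Algebras are [falgType k]: nonzero, finite-dimensional, associative, unital.
A module is a finite-dimensional [k]-space with a bilinear action, rather than
an [lmodType A], so that the [k]-structure is part of the data. *)

Record lmodule (k : fieldType) (A : falgType k) := LModule {
  lcar :> vectType k;
  lact : A -> lcar -> lcar;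
  lact_linl : forall x, linear (lact^~ x);
  lact_linr : forall a, linear (lact a);
  lact1 : forall x, lact 1 x = x;
  lactM : forall a b x, lact (a * b) x = lact a (lact b x)
}.

Record rmodule (k : fieldType) (B : falgType k) := RModule {
  rcar :> vectType k;
  ract : rcar -> B -> rcar;
  ract_linl : forall b, linear (ract^~ b);
  ract_linr : forall x, linear (ract x);
  ract1 : forall x, ract x 1 = x;
  ractM : forall x a b, ract x (a * b) = ract (ract x a) b
}.

(* [k] acts centrally: both actions are [k]-bilinear for the same [k]-space. *)
Record bimodule (k : fieldType) (A B : falgType k) := BiModule {
  bleft :> lmodule A;
  bact : bleft -> B -> bleft;
  bact_linl : forall b, linear (bact^~ b);
  bact_linr : forall x, linear (bact x);
  bact1 : forall x, bact x 1 = x;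
  bactM : forall x a b, bact x (a * b) = bact (bact x a) b;
  bactA : forall a x b, bact (lact a x) b = lact a (bact x b)
}.

Section Homs.
Variables (k : fieldType) (A B : falgType k).

Definition isLHom (X Y : lmodule A) (f : 'Hom(X, Y)) : Prop :=
  forall a x, f (lact a x) = lact a (f x).

Definition isRHom (X Y : rmodule B) (f : 'Hom(X, Y)) : Prop :=
  forall x b, f (ract x b) = ract (f x) b.

Definition lmodule_iso (X Y : lmodule A) : Prop :=
  exists f : 'Hom(X, Y), isLHom f /\ bijective f.

Definition isBimodIso (X Y : bimodule A B) (f : 'Hom(X, Y)) : Prop :=
  [/\ isLHom f, forall x b, f (bact x b) = bact (f x) b & bijective f].

Definition isSubmodule (X : lmodule A) (U : {vspace X}) : Prop :=
  forall a x, x \in U -> lact a x \in U.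

Definition isSimple (X : lmodule A) : Prop :=
  (fullv : {vspace X}) <> 0%VS
  /\ forall U : {vspace X}, isSubmodule U -> U = 0%VS \/ U = fullv.

(* Projectivity is tested on finite-dimensional modules, as all modules are. *)
Definition isLProjective (P : lmodule A) : Prop :=
  forall (X Y : lmodule A) (g : 'Hom(X, Y)) (f : 'Hom(P, Y)),
    isLHom g -> limg g = fullv -> isLHom f ->
    exists h : 'Hom(P, X), isLHom h /\ (g \o h)%VF = f.

Definition isRProjective (P : rmodule B) : Prop :=
  forall (X Y : rmodule B) (g : 'Hom(X, Y)) (f : 'Hom(P, Y)),
    isRHom g -> limg g = fullv -> isRHom f ->
    exists h : 'Hom(P, X), isRHom h /\ (g \o h)%VF = f.

(* [p] is a surjection from a projective with superfluous kernel. *)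
Definition isProjCover (P L : lmodule A) (p : 'Hom(P, L)) : Prop :=
  [/\ isLProjective P, isLHom p, limg p = fullv
    & forall U : {vspace P}, isSubmodule U -> (p @: U)%VS = fullv -> U = fullv].

(* [X] is isomorphic to the subquotient [U / W]; every [k]-linear map on [U]
   extends to the ambient space, so [f] may be taken to be defined there. *)
Definition subquotient_iso (V : lmodule A) (U W : {vspace V}) (X : lmodule A) :
    Prop :=
  exists f : 'Hom(V, X),
    [/\ forall a x, x \in U -> f (lact a x) = lact a (f x),
        (f @: U)%VS = fullv & (U :&: lker f)%VS = W].

Definition filteredBy (C : lmodule A -> Prop) (V : lmodule A) (U : {vspace V}) :
    Prop :=
  exists (n : nat) (F : nat -> {vspace V}),
    [/\ F 0%N = 0%VS, F n = U,
        forall t, (t <= n)%N -> isSubmodule (F t)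
      & forall t, (t < n)%N ->
          (F t <= F t.+1)%VS
          /\ exists2 X, C X & subquotient_iso (F t.+1) (F t) X].

(* End_A(X) is isomorphic to [k] as a [k]-algebra. *)
Definition endo_is_k (X : lmodule A) : Prop :=
  exists phi : k^o -> 'End(X),
    [/\ linear phi, phi 1 = \1%VF,
        forall c d, phi (c * d) = (phi c \o phi d)%VF, injective phi
      & forall f : 'End(X), isLHom f <-> exists c, phi c = f].

End Homs.

(* [K] is the sum of the (possibly infinite) family of subspaces [Fam]. *)
Definition isSumOf (k : fieldType) (V : vectType k) (Fam : {vspace V} -> Prop)
    (K : {vspace V}) : Prop :=
  forall v, v \in K <->
    exists2 s : seq {vspace V},
      (forall U, U \in s -> Fam U) & v \in (\sum_(U <- s) U)%VS.

(** Sim(A) is an indexed family [S : I -> lmodule A] of representatives of the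
simple modules, and the partial order on it is a relation on [I]. *)

Section QuasiHereditary.
Variables (k : fieldType) (A : falgType k).
Variables (I : Type) (S : I -> lmodule A) (le : I -> I -> Prop).

Definition isSim : Prop :=
  [/\ forall i, isSimple (S i),
      forall i j, lmodule_iso (S i) (S j) -> i = j
    & forall X, isSimple X -> exists i, lmodule_iso X (S i)].

(* The images of the maps P(L') -> P with L' not below the simple of index [i]. *)
Definition traceFamily (i : I) (P : lmodule A) (U : {vspace P}) : Prop :=
  exists (j : I) (Q : lmodule A) (q : 'Hom(Q, S j)) (f : 'Hom(Q, P)),
    [/\ ~ le j i, isProjCover q, isLHom f & U = limg f].

(* [X] is isomorphic to the standard module with index [i], the quotient of the
   projective cover of [S i] by the sum of the subspaces above. *)
Definition isStandard (i : I) (X : lmodule A) : Prop :=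
  exists (P : lmodule A) (p : 'Hom(P, S i)) (d : 'Hom(P, X)),
    [/\ isProjCover p, isLHom d, limg d = fullv
      & isSumOf (traceFamily i (P := P)) (lker d)].

Definition standardlyFiltered (V : lmodule A) : Prop :=
  filteredBy (fun X => exists i, isStandard i X) (fullv : {vspace V}).

Definition quasiHereditary : Prop :=
  [/\ isSim, Relation_Definitions.order I le,
      forall i X, isStandard i X -> endo_is_k X
    & forall i (P : lmodule A) (p : 'Hom(P, S i)) (K : {vspace P}),
        isProjCover p -> isSumOf (traceFamily i (P := P)) K ->
        filteredBy (fun X => exists j, [/\ le i j, i <> j & isStandard j X]) K].

Definition directed : Prop :=
  quasiHereditary /\ forall i X, isStandard i X -> isSimple X.

End QuasiHereditary.

Section Restriction.
Variables (k : fieldType) (A B : falgType k) (f : {lrmorphism B -> A}).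

Section Left.
Variable X : lmodule A.
Let act (b : B) (x : X) := lact (f b) x.
Fact lrestr_linl x : linear (act^~ x).
Proof. by move=> c a b; rewrite /act linearP lact_linl. Qed.
Fact lrestr_linr b : linear (act b).
Proof. exact: lact_linr. Qed.
Fact lrestr1 x : act 1 x = x.
Proof. by rewrite /act rmorph1 lact1. Qed.
Fact lrestrM a b x : act (a * b) x = act a (act b x).
Proof. by rewrite /act rmorphM lactM. Qed.
Definition lrestr : lmodule B := LModule lrestr_linl lrestr_linr lrestr1 lrestrM.
End Left.

Let act (a : A) (b : B) := a * f b.
Fact algr_linl b : linear (act^~ b).
Proof. by move=> c x y; rewrite /act mulrDl scalerAl. Qed.
Fact algr_linr a : linear (act a).
Proof. by move=> c x y; rewrite /act linearP mulrDr scalerAr. Qed.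
Fact algr1 a : act a 1 = a.
Proof. by rewrite /act rmorph1 mulr1. Qed.
Fact algrM x a b : act x (a * b) = act (act x a) b.
Proof. by rewrite /act rmorphM mulrA. Qed.
Definition algr : rmodule B := RModule algr_linl algr_linr algr1 algrM.

Section Right.
Variables (C : falgType k) (M : bimodule C A).
Let bactf (x : M) (b : B) := bact x (f b).
Fact brestr_linl b : linear (bactf^~ b).
Proof. exact: bact_linl. Qed.
Fact brestr_linr x : linear (bactf x).
Proof. by move=> c a b; rewrite /bactf linearP bact_linr. Qed.
Fact brestr1 x : bactf x 1 = x.
Proof. by rewrite /bactf rmorph1 bact1. Qed.
Fact brestrM x a b : bactf x (a * b) = bactf (bactf x a) b.
Proof. by rewrite /bactf rmorphM bactM. Qed.
Fact brestrA a x b : bactf (lact a x) b = lact a (bactf x b).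
Proof. exact: bactA. Qed.
Definition brestr : bimodule C B :=
  BiModule brestr_linl brestr_linr brestr1 brestrM brestrA.
End Right.

End Restriction.

Section Tensor.
Variables (k : fieldType) (B : falgType k) (V : rmodule B) (W : lmodule B).

Definition balanced (T : vectType k) (t : V -> W -> T) : Prop :=
  [/\ forall w, linear (t^~ w), forall v, linear (t v)
    & forall v b w, t (ract v b) w = t v (lact b w)].

(* The universal property of the tensor product of [V] and [W] over [B], with
   [t v w] the pure tensors. *)
Definition isTensor (T : vectType k) (t : V -> W -> T) : Prop :=
  balanced t /\
  forall (U : vectType k) (g : V -> W -> U), balanced g ->
    exists! h : 'Hom(T, U), forall v w, h (t v w) = g v w.

End Tensor.

Section Induction.
Variables (k : fieldType) (A B : falgType k) (f : {lrmorphism B -> A}).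

(* [X] is the left [A]-module obtained by inducing [L] from [B] to [A]. *)
Definition isInduced (L : lmodule B) (X : lmodule A) (t : A -> L -> X) : Prop :=
  isTensor (V := algr f) t
  /\ forall a a' l, t (a * a') l = lact a (t a' l).

Definition isInducedBimodule (C : falgType k) (N : bimodule B C)
    (T : bimodule A C) (t : A -> N -> T) : Prop :=
  isInduced t /\ forall a x c, t a (bact x c) = bact (t a x) c.

(* [B] is a subalgebra of [A] via [f]; [J], [T] represent Sim(B). *)
Definition exactBorel (I : Type) (S : I -> lmodule A) (le : I -> I -> Prop) :
    Prop :=
  [/\ quasiHereditary S le, injective f, isRProjective (algr f)
    & exists (J : Type) (T : J -> lmodule B) (phi : J -> I),
        [/\ bijective phi,
            forall j, exists (X : lmodule A) (t : A -> T j -> X),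
              isInduced t /\ isStandard S le (phi j) X
          & directed T (fun j j' => le (phi j) (phi j'))]].

End Induction.

(** [Tri a m b] is the matrix with rows [(a, m)] and [(0, b)]. *)

Definition tri (k : fieldType) (A2 A1 : falgType k) (M : bimodule A2 A1) : Type :=
  (A2 * M * A1)%type.

Section Tri.
Variables (k : fieldType) (A2 A1 : falgType k) (M : bimodule A2 A1).

Definition Tri (a : A2) (m : M) (b : A1) : tri M := (a, m, b).
Definition tri22 (x : tri M) : A2 := x.1.1.
Definition tri21 (x : tri M) : M := x.1.2.
Definition tri11 (x : tri M) : A1 := x.2.

HB.instance Definition _ := Vector.copy (tri M) (A2 * M * A1)%type.

Definition tri_one : tri M := Tri 1 0 1.
Definition tri_mul (x y : tri M) : tri M :=
  Tri (tri22 x * tri22 y)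
      (lact (tri22 x) (tri21 y) + bact (tri21 x) (tri11 y))
      (tri11 x * tri11 y).

Let lact0 a : lact a (0 : M) = 0.
Proof. by have := lact_linr a (-1) (0 : M) 0; rewrite scaler0 add0r scaleN1r addNr. Qed.
Let bact0 b : bact (0 : M) b = 0.
Proof. by have := bact_linl b (-1) (0 : M) 0; rewrite scaler0 add0r scaleN1r addNr. Qed.
Let lactD a (x y : M) : lact a (x + y) = lact a x + lact a y.
Proof. by have := lact_linr a 1 x y; rewrite !scale1r. Qed.
Let lactDl a b (x : M) : lact (a + b) x = lact a x + lact b x.
Proof. by have := lact_linl x 1 a b; rewrite !scale1r. Qed.
Let bactD (x y : M) b : bact (x + y) b = bact x b + bact y b.
Proof. by have := bact_linl b 1 x y; rewrite !scale1r. Qed.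
Let bactDr (x : M) a b : bact x (a + b) = bact x a + bact x b.
Proof. by have := bact_linr x 1 a b; rewrite !scale1r. Qed.
Let lactZ a c (x : M) : lact a (c *: x) = c *: lact a x.
Proof. by have := lact_linr a c x 0; rewrite !addr0 lact0 addr0. Qed.
Let bactZ c (x : M) b : bact (c *: x) b = c *: bact x b.
Proof. by have := bact_linl b c x 0; rewrite !addr0 bact0 addr0. Qed.
Let lact0l (x : M) : lact 0 x = 0.
Proof. by have := lact_linl x (-1) 0 0; rewrite scaler0 add0r scaleN1r addNr. Qed.
Let bact0r (x : M) : bact x 0 = 0.
Proof. by have := bact_linr x (-1) 0 0; rewrite scaler0 add0r scaleN1r addNr. Qed.
Let lactZl a c (x : M) : lact (c *: a) x = c *: lact a x.
Proof. by have := lact_linl x c a 0; rewrite !addr0 lact0l addr0. Qed.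
Let bactZr c (x : M) b : bact x (c *: b) = c *: bact x b.
Proof. by have := bact_linr x c b 0; rewrite !addr0 bact0r addr0. Qed.

Fact tri_mulA : associative tri_mul.
Proof.
move=> x y z; rewrite /tri_mul /tri22 /tri21 /tri11 /Tri /=.
by rewrite lactD bactD !mulrA lactM bactM bactA addrA.
Qed.
Fact tri_mul1 : left_id tri_one tri_mul.
Proof.
move=> [[a m] b]; rewrite /tri_mul /tri_one /tri22 /tri21 /tri11 /Tri /=.
by rewrite !mul1r lact1 bact0 addr0.
Qed.
Fact tri_mulr1 : right_id tri_one tri_mul.
Proof.
move=> [[a m] b]; rewrite /tri_mul /tri_one /tri22 /tri21 /tri11 /Tri /=.
by rewrite !mulr1 bact1 lact0 add0r.
Qed.
Fact tri_mulDl : left_distributive tri_mul +%R.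
Proof.
move=> [[a m] b] [[a' m'] b'] z; rewrite /tri_mul /tri22 /tri21 /tri11 /Tri /=.
by congr (_, _, _); rewrite /= ?mulrDl // lactDl bactD addrACA.
Qed.
Fact tri_mulDr : right_distributive tri_mul +%R.
Proof.
move=> z [[a m] b] [[a' m'] b']; rewrite /tri_mul /tri22 /tri21 /tri11 /Tri /=.
by congr (_, _, _); rewrite /= ?mulrDr // lactD bactDr addrACA.
Qed.
Fact tri_one_neq0 : tri_one != 0.
Proof. by apply/eqP => -[/eqP]; rewrite oner_eq0. Qed.

HB.instance Definition _ := GRing.Zmodule_isNzRing.Build (tri M)
  tri_mulA tri_mul1 tri_mulr1 tri_mulDl tri_mulDr tri_one_neq0.

Fact tri_scaleAl (c : k) (x y : tri M) : c *: (x * y) = (c *: x) * y.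
Proof.
congr (_, _, _); rewrite /= ?scalerAl //.
by rewrite scalerDr /tri22 /tri21 /= lactZl bactZ.
Qed.
HB.instance Definition _ := GRing.Lmodule_isLalgebra.Build k (tri M) tri_scaleAl.

Fact tri_scaleAr (c : k) (x y : tri M) : c *: (x * y) = x * (c *: y).
Proof.
congr (_, _, _); rewrite /= ?scalerAr //.
by rewrite scalerDr /tri21 /tri11 /= lactZ bactZr.
Qed.
HB.instance Definition _ := GRing.Lalgebra_isAlgebra.Build k (tri M) tri_scaleAr.
HB.instance Definition _ := Algebra_isFalgebra.Build k (tri M).

Fact tri22_linear : linear tri22. Proof. by []. Qed.
Fact tri22_monoid : monoid_morphism tri22. Proof. by []. Qed.
HB.instance Definition _ := GRing.isLinear.Build k (tri M) A2 *:%R tri22 tri22_linear.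
HB.instance Definition _ := GRing.isMonoidMorphism.Build (tri M) A2 tri22 tri22_monoid.

Fact tri11_linear : linear tri11. Proof. by []. Qed.
Fact tri11_monoid : monoid_morphism tri11. Proof. by []. Qed.
HB.instance Definition _ := GRing.isLinear.Build k (tri M) A1 *:%R tri11 tri11_linear.
HB.instance Definition _ := GRing.isMonoidMorphism.Build (tri M) A1 tri11 tri11_monoid.

(* Sim(A) is the disjoint union of Sim(A1) and Sim(A2), inflated along the two
   diagonal projections. *)
Definition triSim (I1 I2 : Type) (S1 : I1 -> lmodule A1) (S2 : I2 -> lmodule A2)
    (i : I1 + I2) : lmodule (tri M) :=
  match i with
  | inl i1 => lrestr tri11 (S1 i1)
  | inr i2 => lrestr tri22 (S2 i2)
  end.

End Tri.

Definition triLe (I1 I2 : Type) (le1 : I1 -> I1 -> Prop) (le2 : I2 -> I2 -> Prop)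
    (i j : I1 + I2) : Prop :=
  match i, j with
  | inl i1, inl j1 => le1 i1 j1
  | inr i2, inr j2 => le2 i2 j2
  | inl _, inr _ => True
  | inr _, inl _ => False
  end.

(* Main.v *)
(** A module [X] over the triangular ring [A] has the [A2]-submodule [e2 X],
with quotient the [A1]-module [X / e2 X].  Standard modules of [A] are
inflated from [A2] and [A1].  If [P] is the projective cover of an inflated
simple [A1]-module, then [P / e2 P] is its projective cover over [A1] and
[e2 P] is a direct summand of [M]; so [A] is quasi-hereditary because standardly
filtered modules over a quasi-hereditary algebra are closed under direct
summands.  The latter holds because, for a maximal label [i] of a filtered
module [V], the cokernel of every nonzero map from the standard module of [i]
to [V] is again filtered.  The same argument for [N] over the directed algebra
[B2], where every module is standardly filtered, shows that [B] is directed.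

A dual basis of the right module [A2] over [B2] also expands [A2 (x) N], so
together with one of [A1] over [B1] it yields a dual basis of [A] over [B].
The embedding is injective since [A2] is faithfully flat over [B2]. *)

Require Import Defs.
From HB Require Import structures.
From Stdlib Require Import Classical FunctionalExtensionality.
From mathcomp Require Import all_boot all_order all_algebra all_field.

Set Implicit Arguments.
Unset Strict Implicit.
Unset Printing Implicit Defensive.

Import GRing.Theory.
Local Open Scope ring_scope.

(** Call a label admissible for [i] if it is at most [i]. The quotient of a projective by its trace
    is its largest quotient with admissible composition factors only; this universal property
    compares standard modules over different rings without computing traces. Every label of [A2]
    lies above every label of [A1], so an [A]-module with labels admissible for a label of [A1] has
    zero [e2]-part, while a projective [A2]-module stays projective after inflation. Hence standard
    modules are inflated. The kernel of [P -> Delta] at a label of [A1] is an extension of the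
    corresponding kernel over [A1] by [e2 P], and all that is known of [e2 P] is that it is a
    retract of [M = e2 A e1]; this forces the closure under summands. Quasi-heredity of [A] is
    proved because [exactBorel] contains it. The isomorphism of [M] with [A2 (x) N] serves the
    injectivity, the dual basis, and also the induction of simple [B1]-modules: there the entry [M]
    must die in the tensor product, and it does since [N] generates [M] over [A2] and acts as zero
    on modules inflated from [B1]. *)

Section Subspaces.
Variables (k : fieldType) (V : vectType k).

(** Stands in for Zorn's lemma with an arbitrary predicate: a strict inclusion lowers the dimension.
    It provides simple submodules and projective covers; the dual below provides simple quotients
    and infinite sums. *)
Lemma minimal_vspace (Q : {vspace V} -> Prop) (U : {vspace V}) : Q U ->
  exists W, [/\ Q W, (W <= U)%VS
    & forall W', Q W' -> (W' <= W)%VS -> W' = W].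
Proof.
have [n] := ubnP (\dim U); elim: n U => // n IHn U leUn QU.
have [minU | /not_all_ex_not [W nW]] :=
  classic (forall W', Q W' -> (W' <= U)%VS -> W' = U).
  by exists U; split.
have [QW [sWU neqWU]] : Q W /\ (W <= U)%VS /\ W <> U by tauto.
have ltWU : (\dim W < \dim U)%N.
  rewrite ltn_neqAle (dimvS sWU) andbT (dimv_leqif_eq sWU).
  exact/eqP.
have [|W0 [QW0 sW0 minW0]] := IHn W _ QW; first exact: leq_trans ltWU _.
by exists W0; split=> //; apply: subv_trans sWU.
Qed.

Lemma maximal_vspace (Q : {vspace V} -> Prop) (U : {vspace V}) : Q U ->
  exists W, [/\ Q W, (U <= W)%VS
    & forall W', Q W' -> (W <= W')%VS -> W' = W].
Proof.
have [n] := ubnP (\dim {:V} - \dim U)%N; elim: n U => // n IHn U leUn QU.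
have [maxU | /not_all_ex_not [W nW]] :=
  classic (forall W', Q W' -> (U <= W')%VS -> W' = U).
  by exists U; split.
have [QW [sUW neqWU]] : Q W /\ (U <= W)%VS /\ W <> U by tauto.
have ltUW : (\dim U < \dim W)%N.
  rewrite ltn_neqAle (dimvS sUW) andbT (dimv_leqif_eq sUW).
  by apply/eqP => /esym.
have [|W0 [QW0 sW0 maxW0]] := IHn W _ QW.
  apply: leq_trans _ (leUn : (_ <= n)%N); rewrite ltn_sub2l //.
  by apply: leq_trans ltUW _; apply/dimvS/subvf.
by exists W0; split=> //; apply: subv_trans sW0.
Qed.

(** A finite partial sum that is maximal for inclusion absorbs every other finite sum. *)
Lemma isSumOf_exists (Fam : {vspace V} -> Prop) : exists K, isSumOf Fam K.
Proof.
pose Q (W : {vspace V}) := exists2 s : seq {vspace V},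
  (forall U, U \in s -> Fam U) & W = (\sum_(U <- s) U)%VS.
have [|W [[s sF ->] _ maxW]] := @maximal_vspace Q 0%VS.
  by exists [::]; rewrite ?big_nil.
exists (\sum_(U <- s) U)%VS => v; split=> [vs | [s' s'F vs']]; first by exists s.
have <- : (\sum_(U <- s' ++ s) U)%VS = (\sum_(U <- s) U)%VS.
  apply: maxW; last by rewrite big_cat addvSr.
  exists (s' ++ s) => // U; rewrite mem_cat => /orP[]; [exact: s'F | exact: sF].
by rewrite big_cat; apply: subvP vs'; apply: addvSl.
Qed.

End Subspaces.

Lemma isSumOf_sup (k : fieldType) (V : vectType k) Fam (K U : {vspace V}) :
  isSumOf Fam K -> Fam U -> (U <= K)%VS.
Proof.
move=> sumK FU; apply/subvP => v vU; apply/sumK; exists [:: U].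
  by move=> W; rewrite inE => /eqP->.
by rewrite big_seq1.
Qed.

Lemma isSumOf_sub (k : fieldType) (V : vectType k) Fam (K W : {vspace V}) :
  isSumOf Fam K -> (forall U, Fam U -> (U <= W)%VS) -> (K <= W)%VS.
Proof.
move=> sumK FW; apply/subvP => v /sumK[s sF]; apply/subvP.
elim: s sF => [|U s IHs] sF; first by rewrite big_nil sub0v.
rewrite big_cons subv_add FW /=; last exact/sF/mem_head.
by apply: IHs => U' U's; apply: sF; rewrite inE U's orbT.
Qed.

Section Maps.
Variables (k : fieldType) (V W : vectType k).
Implicit Type f : 'Hom(V, W).

Definition mono f := forall x, f x = 0 -> x = 0.
Definition epi f := forall y, exists x, f x = y.

Lemma epiP f : epi f <-> limg f = fullv.
Proof.
split=> [ef | fT y].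
  apply/vspaceP => y; rewrite memvf; have [x <-] := ef y.
  by rewrite memv_img ?memvf.
by have := memvf y; rewrite -fT => /memv_imgP[x _ ->]; exists x.
Qed.

Lemma mono_ker f : mono f -> lker f == 0%VS.
Proof.
move=> mf; rewrite -subv0; apply/subvP => x.
by rewrite memv_ker memv0 => /eqP/mf->.
Qed.

Lemma inj_of_mono f : mono f -> injective f.
Proof. by move/mono_ker/lker0P. Qed.

Lemma inj_mono f : injective f -> mono f.
Proof. by move=> fI x fx0; apply: fI; rewrite fx0 linear0. Qed.

Lemma bij_lfun f : bijective f <-> mono f /\ epi f.
Proof.
split=> [bf | [mf ef]].
  split; first exact: inj_mono (bij_inj bf).
  by case: bf => g fK gK y; exists (g y); rewrite gK.
exists (f^-1)%VF; first exact/lker0_lfunK/mono_ker.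
by move=> y; rewrite limg_lfunVK // (proj1 (epiP f) ef) memvf.
Qed.

Lemma epi_dim f : epi f -> (\dim {:W} <= \dim {:V})%N.
Proof. by move/epiP <-; rewrite -(limg_ker_dim f fullv) leq_addl. Qed.

Lemma epi_mono f : epi f -> (\dim {:V} <= \dim {:W})%N -> mono f.
Proof.
move/epiP=> fT ledim x fx0; apply/eqP; rewrite -memv0.
suff /eqP <- : (lker f == 0)%VS by rewrite memv_ker fx0.
move: ledim; rewrite -(limg_ker_dim f fullv) fT capfv.
by rewrite -{2}[\dim {:W}]add0n leq_add2r leqn0 dimv_eq0.
Qed.

Lemma mono_epi f : mono f -> (\dim {:W} <= \dim {:V})%N -> epi f.
Proof.
move/mono_ker/eqP => f0 ledim; apply/epiP/eqP.
by rewrite eqEdim subvf limg_dim_eq // f0 capv0.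
Qed.

End Maps.

HB.instance Definition _ (k : fieldType) (A : falgType k) (X : lmodule A) a :=
  GRing.isLinear.Build k X X *:%R (@lact k A X a) (@lact_linr k A X a).

(** * Module homomorphisms, submodules and quotients *)

Section Modules.
Variables (k : fieldType) (A : falgType k).
Implicit Types X Y Z : lmodule A.

Definition orbit_map X (x : X) (a : A) : X := lact a x.

HB.instance Definition _ X x :=
  GRing.isLinear.Build k A X *:%R (@orbit_map X x) (lact_linl x).

Lemma lactDl X a b (x : X) : lact (a + b) x = lact a x + lact b x.
Proof. exact: (linearD (orbit_map x)). Qed.

Lemma lact0l X (x : X) : lact 0 x = 0.
Proof. exact: (linear0 (orbit_map x)). Qed.

Lemma lactZl X c a (x : X) : lact (c *: a) x = c *: lact a x.
Proof. exact: (linearZ_LR (orbit_map x)). Qed.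

Lemma hom_comp X Y Z (g : 'Hom(Y, Z)) (f : 'Hom(X, Y)) :
  isLHom g -> isLHom f -> isLHom (g \o f)%VF.
Proof. by move=> hg hf a x; rewrite !comp_lfunE hf hg. Qed.

Lemma hom_id X : isLHom (\1%VF : 'End(X)).
Proof. by move=> a x; rewrite !id_lfunE. Qed.

Lemma hom_inv X Y (f : 'Hom(X, Y)) : isLHom f -> mono f -> epi f ->
  exists g : 'Hom(Y, X), [/\ isLHom g, cancel f g & cancel g f].
Proof.
move=> hf mf ef; have fK := lker0_lfunK (mono_ker mf); exists (f^-1)%VF.
have Kf : cancel (f^-1)%VF f.
  by move=> y; rewrite limg_lfunVK // (proj1 (epiP f) ef) memvf.
by split=> // a y; rewrite -{1}[y]Kf -hf fK.
Qed.

Lemma factor_epi X Y Z (g : 'Hom(X, Y)) (f : 'Hom(X, Z)) :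
  isLHom g -> isLHom f -> epi g -> (forall x, g x = 0 -> f x = 0) ->
  exists h : 'Hom(Y, Z), isLHom h /\ forall x, h (g x) = f x.
Proof.
(* [g^-1] is only a [k]-linear section of [g]; the composite is [A]-linear because [f] kills the
   kernel of [g]. *)
move=> hg hf eg gf; exists (f \o g^-1)%VF.
have gK y : g ((g^-1)%VF y) = y.
  by rewrite limg_lfunVK // (proj1 (epiP g) eg) memvf.
have hgE x : (f \o g^-1)%VF (g x) = f x.
  rewrite comp_lfunE; apply/eqP; rewrite -subr_eq0 -linearB; apply/eqP/gf.
  by rewrite linearB /= gK subrr.
split=> // a y; have [x <-] := eg y.
by rewrite -hg !hgE hf.
Qed.

Lemma factor_mono X Y Z (f : 'Hom(X, Z)) (g : 'Hom(Y, Z)) :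
  isLHom f -> isLHom g -> mono f -> (forall y, exists x, f x = g y) ->
  exists h : 'Hom(Y, X), isLHom h /\ forall y, f (h y) = g y.
Proof.
move=> hf hg mf gf; have fK := lker0_lfunK (mono_ker mf).
have fE y : f ((f^-1 \o g)%VF y) = g y.
  by rewrite comp_lfunE; have [x <-] := gf y; rewrite fK.
exists (f^-1 \o g)%VF; split=> // a y; apply: (inj_of_mono mf).
by rewrite fE hf fE hg.
Qed.

Section Sub.
Variables (X : lmodule A) (U : {vspace X}) (subU : isSubmodule U).
Let act a (u : subvs_of U) : subvs_of U := vsproj U (lact a (vsval u)).
Let actE a u : vsval (act a u) = lact a (vsval u).
Proof. by rewrite /act vsprojK // subU ?subvsP. Qed.
Fact sub_linl u : linear (act^~ u).
Proof. by move=> c a b; apply: subvs_inj; rewrite linearP /= !actE lactDl lactZl. Qed.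
Fact sub_linr a : linear (act a).
Proof. by move=> c u v; apply: subvs_inj; rewrite linearP /= !actE linearP. Qed.
Fact sub_act1 u : act 1 u = u.
Proof. by apply: subvs_inj; rewrite actE lact1. Qed.
Fact sub_actM a b u : act (a * b) u = act a (act b u).
Proof. by apply: subvs_inj; rewrite !actE lactM. Qed.
Definition submod := LModule sub_linl sub_linr sub_act1 sub_actM.

Lemma submodule_exists : exists (Y : lmodule A) (f : 'Hom(Y, X)),
  [/\ isLHom f, mono f & limg f = U].
Proof.
exists submod, (linfun (vsval : submod -> X)); split.
- by move=> a u; rewrite !lfunE /= actE.
- by move=> u; rewrite lfunE => u0; apply: subvs_inj; rewrite linear0.
apply/vspaceP => x; apply/memv_imgP/idP => [[u _ ->]|xU].
  by rewrite lfunE subvsP.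
by exists (vsproj U x); rewrite ?memvf // lfunE /= vsprojK.
Qed.
End Sub.

Section Quo.
Variables (X : lmodule A) (U : {vspace X}) (subU : isSubmodule U).
(** The quotient lives on the chosen complement [U^C]: [pi] removes the component in [U], and [A]
    acts as on [X] followed by [pi]. *)
Let pi (x : X) : subvs_of U^C := vsproj U^C (x - projv U x).
Let piE x : vsval (pi x) = x - projv U x.
Proof. by rewrite vsprojK ?memv_projC. Qed.
Let pi_lin : linear pi.
Proof.
move=> c x y; apply: subvs_inj; rewrite linearP /= !piE linearP /=.
by rewrite scalerBr opprD addrACA.
Qed.
Let pi0 x : (pi x == 0) = (x \in U).
Proof.
rewrite -(inj_eq (@subvs_inj _ _ _)) piE linear0 subr_eq0.
by apply/eqP/idP => [->|xU]; rewrite ?memv_proj ?projv_id.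
Qed.
Let pi_eq x y : x - y \in U -> pi x = pi y.
Proof.
rewrite -pi0 => /eqP pixy; apply/eqP; rewrite -subr_eq0.
by have := pi_lin (-1) y x; rewrite !scaleN1r ![- _ + _]addrC pixy => <-.
Qed.
Let piK (u : subvs_of U^C) : pi (vsval u) = u.
Proof.
apply: subvs_inj; rewrite piE.
suff -> : projv U (vsval u) = 0 by rewrite subr0.
by apply/eqP; rewrite -memv_ker lker_proj subvsP.
Qed.
Let act a (u : subvs_of U^C) : subvs_of U^C := pi (lact a (vsval u)).
Let actE a x : act a (pi x) = pi (lact a x).
Proof.
apply: pi_eq; rewrite piE -linearB addrAC subrr add0r linearN memvN.
by rewrite subU ?memv_proj.
Qed.
Fact quo_linl u : linear (act^~ u).
Proof. by move=> c a b; rewrite /act lactDl lactZl pi_lin. Qed.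
Fact quo_linr a : linear (act a).
Proof. by move=> c u v; rewrite /act !linearP pi_lin. Qed.
Fact quo_act1 u : act 1 u = u.
Proof. by rewrite /act lact1 piK. Qed.
Fact quo_actM a b u : act (a * b) u = act a (act b u).
Proof. by rewrite /act lactM -!/(act _ _) {2}/act actE. Qed.
Definition quomod := LModule quo_linl quo_linr quo_act1 quo_actM.
HB.instance Definition _ := GRing.isLinear.Build k X quomod *:%R pi pi_lin.

Lemma quotient_exists : exists (Y : lmodule A) (g : 'Hom(X, Y)),
  [/\ isLHom g, epi g & lker g = U].
Proof.
exists quomod, (linfun (pi : X -> quomod)); split.
- by move=> a u; rewrite !lfunE /= -actE.
- by move=> u; exists (vsval u); rewrite lfunE; apply: piK.
- by apply/vspaceP => x; rewrite memv_ker lfunE -pi0.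
Qed.
End Quo.

End Modules.

(** * Exact sequences, projective covers and filtrations *)

Section Exactness.
Variables (k : fieldType) (A : falgType k).
Implicit Types X Y Z P Q L : lmodule A.

Definition ses X Y Z (f : 'Hom(X, Y)) (g : 'Hom(Y, Z)) : Prop :=
  [/\ isLHom f, isLHom g, mono f, epi g
    & forall y, g y = 0 <-> exists x, f x = y].

Lemma ses_comp0 X Y Z (f : 'Hom(X, Y)) (g : 'Hom(Y, Z)) x :
  ses f g -> g (f x) = 0.
Proof. by case=> _ _ _ _ fg; apply/fg; exists x. Qed.

Lemma lker_sub X Y (g : 'Hom(X, Y)) : isLHom g -> isSubmodule (lker g).
Proof. by move=> hg a x; rewrite !memv_ker hg => /eqP->; rewrite linear0. Qed.

Lemma limg_sub X Y (f : 'Hom(X, Y)) (U : {vspace X}) :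
  isLHom f -> isSubmodule U -> isSubmodule (f @: U)%VS.
Proof.
by move=> hf sU a _ /memv_imgP[x xU ->]; rewrite -hf memv_img ?sU.
Qed.

Lemma full_sub X : isSubmodule (fullv : {vspace X}).
Proof. by move=> a x _; rewrite memvf. Qed.

Lemma memv_limg X Y (f : 'Hom(X, Y)) y :
  y \in limg f <-> exists x, f x = y.
Proof.
split=> [/memv_imgP[x _ ->]|[x <-]]; first by exists x.
by rewrite memv_img ?memvf.
Qed.

Lemma kernel_exists Y Z (g : 'Hom(Y, Z)) : isLHom g ->
  exists X (f : 'Hom(X, Y)), [/\ isLHom f, mono f
    & forall y, g y = 0 <-> exists x, f x = y].
Proof.
move=> hg; have [X [f [hf mf fE]]] := submodule_exists (lker_sub hg).
exists X, f; split=> // y; rewrite -memv_limg fE memv_ker.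
by split=> [->|/eqP].
Qed.

Lemma cokernel_exists X Y (f : 'Hom(X, Y)) : isLHom f ->
  exists Z (g : 'Hom(Y, Z)), [/\ isLHom g, epi g
    & forall y, g y = 0 <-> exists x, f x = y].
Proof.
move=> hf; have [Z [g [hg eg gE]]] := quotient_exists (limg_sub hf (@full_sub X)).
exists Z, g; split=> // y; rewrite -memv_limg -gE memv_ker.
by split=> [->|/eqP].
Qed.

Lemma lfun_neq0 (V W : vectType k) (f : 'Hom(V, W)) :
  f != 0 -> exists x, f x != 0.
Proof. by case/lfunPn=> x; rewrite zero_lfunE; exists x. Qed.

Lemma simple_epi X L (f : 'Hom(X, L)) : isSimple L -> isLHom f -> f != 0 -> epi f.
Proof.
move=> [_ sL] hf /lfun_neq0[x fx]; apply/epiP.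
have [f0|//] := sL _ (limg_sub hf (@full_sub X)).
by move: fx; rewrite -memv0 -f0 memv_img ?memvf.
Qed.

Lemma simple_mono X L (f : 'Hom(L, X)) : isSimple L -> isLHom f -> f != 0 -> mono f.
Proof.
move=> [_ sL] hf /lfun_neq0[x fx].
have [f0|ff] := sL _ (lker_sub hf).
  by move=> y fy; apply/eqP; rewrite -memv0 -f0 memv_ker fy.
by move: fx; rewrite -memv_ker ff memvf.
Qed.

Lemma simple_neq0 L : isSimple L -> exists x : L, x != 0.
Proof.
move=> [nL _]; exists (vpick (fullv : {vspace L})).
by rewrite vpick0; apply/eqP.
Qed.

Lemma simple_quotient X : (fullv : {vspace X}) <> 0%VS ->
  exists L (g : 'Hom(X, L)), [/\ isSimple L, isLHom g & epi g].
Proof.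
move=> nX; pose Q (U : {vspace X}) := isSubmodule U /\ U <> fullv.
have [|U [[sU nU] _ maxU]] := @maximal_vspace _ _ Q 0%VS.
  by split; [move=> a x; rewrite !memv0 => /eqP->; rewrite linear0 | exact/nesym].
have [L [g [hg eg gU]]] := quotient_exists sU.
have /epiP gT := eg.
exists L, g; split=> //; split=> [L0 | W sW].
  apply: nU; apply/vspaceP => x; rewrite memvf -gU memv_ker.
  by rewrite -memv0 -L0 memvf.
have imW : (g @: (g @^-1: W))%VS = W by rewrite lpreimK // gT subvf.
have [fW|nW] := eqVneq (g @^-1: W)%VS fullv; first by right; rewrite -imW fW.
left; rewrite -imW (_ : _ @^-1: W = U)%VS; first by apply/eqP; rewrite -lkerE gU.
apply: maxU; last by rewrite -gU -lpreim0 lpreimS ?sub0v.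
split; last exact/eqP.
by move=> a x; rewrite -!memv_preim hg => /sW.
Qed.

Lemma simple_submodule X : (fullv : {vspace X}) <> 0%VS ->
  exists L (f : 'Hom(L, X)), [/\ isSimple L, isLHom f & mono f].
Proof.
move=> nX; pose Q (U : {vspace X}) := isSubmodule U /\ U <> 0%VS.
have [|U [[sU nU] _ minU]] := @minimal_vspace _ _ Q fullv.
  by split=> //; apply: full_sub.
have [L [f [hf mf fU]]] := submodule_exists sU.
have f0 := mono_ker mf.
exists L, f; split=> //; split=> [L0 | W sW].
  by apply: nU; rewrite -fU L0 limg0.
have [W0|/eqP nW] := eqVneq W 0%VS; [by left | right].
apply/eqP; rewrite -(eq_limg_ker0 _ _ f0) fU; apply/eqP/minU.
  split; first exact: limg_sub.
  by move/eqP; rewrite -(limg0 f) (eq_limg_ker0 _ _ f0) => /eqP.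
by rewrite -fU limgS ?subvf.
Qed.

Lemma proj_lift P X Y (g : 'Hom(X, Y)) (f : 'Hom(P, Y)) :
  isLProjective P -> isLHom g -> epi g -> isLHom f ->
  exists h : 'Hom(P, X), isLHom h /\ forall x, g (h x) = f x.
Proof.
move=> pP hg /epiP eg hf; have [h [hh ghf]] := pP _ _ _ _ hg eg hf.
by exists h; split=> // x; rewrite -comp_lfunE ghf.
Qed.

Lemma proj_retract P Q (u : 'Hom(P, Q)) (w : 'Hom(Q, P)) :
  isLProjective Q -> isLHom u -> isLHom w -> (forall x, w (u x) = x) ->
  isLProjective P.
Proof.
move=> pQ hu hw wu X Y g f hg /epiP eg hf.
have [h [hh gh]] := proj_lift pQ hg eg (hom_comp hf hw).
exists (h \o u)%VF; split; first exact: hom_comp.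
by apply/lfunP => x; rewrite !comp_lfunE gh comp_lfunE wu.
Qed.

Lemma cover_proj P L (p : 'Hom(P, L)) : isProjCover p -> isLProjective P.
Proof. by case. Qed.

Lemma cover_hom P L (p : 'Hom(P, L)) : isProjCover p -> isLHom p.
Proof. by case. Qed.

Lemma cover_epi P L (p : 'Hom(P, L)) : isProjCover p -> epi p.
Proof. by case=> _ _ /epiP. Qed.

(** Superfluity of the kernel in terms of maps instead of subspaces; [coverI] is the converse. *)
Lemma cover_essential X P L (p : 'Hom(P, L)) (f : 'Hom(X, P)) :
  isProjCover p -> isLHom f -> (forall y, exists x, p (f x) = y) -> epi f.
Proof.
move=> [_ _ _ ess] hf pf; apply/epiP/ess; first exact: limg_sub (@full_sub X).
apply/vspaceP => y; rewrite memvf; have [x <-] := pf y.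
by rewrite !memv_img ?memvf.
Qed.

Lemma coverI P L (p : 'Hom(P, L)) : isLProjective P -> isLHom p -> epi p ->
  (forall X (f : 'Hom(X, P)), isLHom f -> (forall y, exists x, p (f x) = y) ->
    epi f) ->
  isProjCover p.
Proof.
move=> pP hp /epiP ep ess; split=> // U sU pU.
have [X [f [hf _ fU]]] := submodule_exists sU.
rewrite -fU; apply/epiP/ess => // y.
have := memvf y; rewrite -pU => /memv_imgP[x xU ->].
by move: xU; rewrite -fU => /memv_imgP[z _ ->]; exists z.
Qed.

Lemma cover_lift P Q L L' (p : 'Hom(P, L)) (q : 'Hom(Q, L')) (u : 'Hom(L, L')) :
  isProjCover p -> isProjCover q -> isLHom u -> bijective u ->
  exists h : 'Hom(P, Q), [/\ isLHom h, epi h & forall x, q (h x) = u (p x)].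
Proof.
move=> cp cq hu /bij_lfun[_ eu].
have [h [hh qh]] := proj_lift (cover_proj cp) (cover_hom cq) (cover_epi cq)
  (hom_comp hu (cover_hom cp)).
exists h; split=> //; last by move=> x; rewrite qh comp_lfunE.
apply: cover_essential cq hh _ => y; have [z <-] := eu y.
by have [x <-] := cover_epi cp z; exists x; rewrite qh comp_lfunE.
Qed.

(** Lifting in both directions gives surjections both ways, so the dimensions agree and a surjection
    is already injective. *)
Lemma cover_iso P Q L L' (p : 'Hom(P, L)) (q : 'Hom(Q, L')) (u : 'Hom(L, L')) :
  isProjCover p -> isProjCover q -> isLHom u -> bijective u ->
  exists h : 'Hom(P, Q),
    [/\ isLHom h, bijective h & forall x, q (h x) = u (p x)].
Proof.
move=> cp cq hu bu; have [h [hh eh qh]] := cover_lift cp cq hu bu.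
exists h; split=> //; apply/bij_lfun; split=> //; apply: epi_mono => //.
have [mu eu] := proj1 (bij_lfun u) bu.
have [v [hv uK vK]] := hom_inv hu mu eu.
have bv : bijective v by exists u.
by have [h' [_ eh' _]] := cover_lift cq cp hv bv; apply: epi_dim eh'.
Qed.

Lemma cover_iso_id P Q L (p : 'Hom(P, L)) (q : 'Hom(Q, L)) :
  isProjCover p -> isProjCover q ->
  exists h : 'Hom(P, Q), [/\ isLHom h, bijective h & forall x, q (h x) = p x].
Proof.
move=> cp cq; have [||h [hh bh qh]] := @cover_iso _ _ _ _ _ _ \1%VF cp cq.
- exact: hom_id.
- by exists id => x; rewrite !id_lfunE.
by exists h; split=> // x; rewrite qh id_lfunE.
Qed.

End Exactness.

(** * Existence of projective covers of simple modules *)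

Section Regular.
Variables (k : fieldType) (A : falgType k).

Let act (a x : A) : A := a * x.
Fact regular_linl x : linear (act^~ x).
Proof. by move=> c a b; rewrite /act mulrDl scalerAl. Qed.
Fact regular_linr a : linear (act a).
Proof. by move=> c x y; rewrite /act mulrDr scalerAr. Qed.
Fact regular1 x : act 1 x = x. Proof. exact: mul1r. Qed.
Fact regularM a b x : act (a * b) x = act a (act b x).
Proof. by rewrite /act mulrA. Qed.
Definition regular : lmodule A :=
  LModule regular_linl regular_linr regular1 regularM.

Definition orbit_hom (X : lmodule A) (x : X) : 'Hom(regular, X) :=
  linfun (orbit_map x : regular -> X).

Lemma orbit_homE (X : lmodule A) (x : X) a : orbit_hom x a = lact a x.
Proof. by rewrite lfunE. Qed.

Lemma orbit_hom_hom (X : lmodule A) (x : X) : isLHom (orbit_hom x).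
Proof. by move=> a b; rewrite !orbit_homE lactM. Qed.

Lemma regular_proj : isLProjective regular.
Proof.
move=> X Y g f hg /epiP eg hf; have [x gx] := eg (f (1 : A)).
exists (orbit_hom x); split; first exact: orbit_hom_hom.
apply/lfunP => a; rewrite comp_lfunE orbit_homE hg gx -hf.
by rewrite /= /act mulr1.
Qed.

(** A submodule of the regular module, minimal among those mapping onto [L], covers [L] essentially.
    For projectivity, lift the orbit map to [h] from [A] to [P]; the endomorphism [h \o f] of [P] is
    surjective by essentiality, hence invertible, and [P] is a retract of [A]. *)
Lemma simple_cover_exists (L : lmodule A) : isSimple L ->
  exists (P : lmodule A) (p : 'Hom(P, L)), isProjCover p.
Proof.
move=> sL; have [x x0] := simple_neq0 sL; have hx := @orbit_hom_hom L x.
have ex : epi (orbit_hom x).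
  apply: simple_epi => //; apply/lfunPn; exists (1 : A).
  by rewrite orbit_homE lact1 zero_lfunE.
pose Q (U : {vspace regular}) := isSubmodule U /\ (orbit_hom x @: U)%VS = fullv.
have [|U [[sU xU] _ minU]] := @minimal_vspace _ _ Q fullv.
  by split; [exact: full_sub | exact/epiP].
have [P [f [hf mf fU]]] := submodule_exists sU.
have hp : isLHom (orbit_hom x \o f)%VF by exact: hom_comp.
have ep : epi (orbit_hom x \o f)%VF by apply/epiP; rewrite limg_comp fU.
have ess (X : lmodule A) (g : 'Hom(X, P)) : isLHom g ->
    (forall y, exists z, (orbit_hom x \o f)%VF (g z) = y) -> epi g.
  move=> hg eg; suff fgU : limg (f \o g)%VF = U.
    move=> y; have : f y \in limg (f \o g)%VF.
      by rewrite fgU -fU memv_img ?memvf.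
    case/memv_limg=> z; rewrite comp_lfunE => /(inj_of_mono mf) <-.
    by exists z.
  apply: minU; last first.
    by rewrite limg_comp -fU limgS ?subvf.
  split; first exact: limg_sub (hom_comp hf hg) (@full_sub _ _ X).
  rewrite -limg_comp; apply/epiP => y; have [z <-] := eg y.
  by exists z; rewrite !comp_lfunE.
exists P, (orbit_hom x \o f)%VF; apply: coverI => //.
have [h [hh ph]] := proj_lift regular_proj hp ep hx.
have ehf : epi (h \o f)%VF.
  apply: ess; first exact: hom_comp.
  by move=> y; have [z <-] := ep y; exists z; rewrite (comp_lfunE h f) ph -comp_lfunE.
have mhf := epi_mono ehf (leqnn _).
have [w [hw _ wK]] := hom_inv (hom_comp hh hf) mhf ehf.
apply: (proj_retract regular_proj (hom_comp hf hw) hh) => z.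
by rewrite comp_lfunE -(comp_lfunE h) wK.
Qed.

End Regular.

(** * Filtrations as iterated extensions *)

Section Filtrations.
Variables (k : fieldType) (A : falgType k).
Implicit Types (X Y Z V : lmodule A) (C : lmodule A -> Prop).

(** Intrinsic form of [filteredBy]: the top layer is split off with no ambient chain of subspaces,
    so that arguments go by induction on the module and up to isomorphism. *)
Inductive filt C : lmodule A -> Prop :=
| filt0 X : (fullv : {vspace X}) = 0%VS -> filt C X
| filt_step X Y Z (f : 'Hom(X, Y)) (g : 'Hom(Y, Z)) :
    ses f g -> filt C X -> C Z -> filt C Y.

Lemma zero_eq X (x : X) : (fullv : {vspace X}) = 0%VS -> x = 0.
Proof. by move=> X0; apply/eqP; rewrite -memv0 -X0 memvf. Qed.

Lemma filtW C C' X : (forall Z, C Z -> C' Z) -> filt C X -> filt C' X.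
Proof.
move=> CC'; elim=> {X} [X X0 | X Y Z f g fg _ IH CZ]; first exact: filt0.
exact: filt_step fg IH (CC' _ CZ).
Qed.

Lemma filt_iso C X Y (h : 'Hom(X, Y)) :
  isLHom h -> bijective h -> filt C X -> filt C Y.
Proof.
move=> hh /bij_lfun[mh eh] fX.
case: fX h hh mh eh => {X} [X X0 | X V Z f g [hf hg mf eg fg] fX CZ] h hh mh eh.
  by apply: filt0; rewrite -(proj1 (epiP h) eh) X0 limg0.
have [h' [hh' hK h'K]] := hom_inv hh mh eh.
apply: (@filt_step C X Y Z (h \o f)%VF (g \o h')%VF) => //.
split; [exact: hom_comp | exact: hom_comp | | |].
- by move=> x; rewrite comp_lfunE => /mh/mf.
- by move=> z; have [v <-] := eg z; exists (h v); rewrite comp_lfunE hK.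
move=> y; rewrite comp_lfunE fg; split=> [[x fx]|[x <-]]; exists x.
  by rewrite comp_lfunE fx h'K.
by rewrite comp_lfunE hK.
Qed.

Lemma filt_ext C X Y Z (f : 'Hom(X, Y)) (g : 'Hom(Y, Z)) :
  ses f g -> filt C X -> filt C Z -> filt C Y.
Proof.
move=> fg fX fZ; elim: fZ Y f g fg => {Z} [Z Z0 | Z' Z W u v uv _ IH CW] Y f g fg.
  have [hf _ mf _ ker] := fg; apply: (filt_iso hf) fX; apply/bij_lfun; split=> //.
  by move=> y; apply/ker/zero_eq.
have [hf hg mf eg kfg] := fg; have [hu hv mu ev kuv] := uv.
(* [Y'] is the preimage in [Y] of [Z'], the part of [Z] below its top layer [W]; it is an extension
   of [Z'] by [X], so the induction hypothesis applies to it. *)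
have [Y' [i [hi mi kvg]]] := kernel_exists (hom_comp hv hg).
have [|f' [hf' f'E]] := factor_mono hi hf mi.
  by move=> x; apply/kvg; rewrite comp_lfunE (ses_comp0 _ fg) linear0.
have [|g' [hg' g'E]] := factor_mono hu (hom_comp hg hi) mu.
  move=> y'; apply/kuv; rewrite comp_lfunE -(comp_lfunE v).
  by apply/kvg; exists y'.
apply: (@filt_step C Y' Y W i (v \o g)%VF _ _ CW).
  split=> //; first exact: hom_comp.
  move=> w; have [z <-] := ev w; have [y <-] := eg z.
  by exists y; rewrite comp_lfunE.
apply: (IH Y' f' g'); split=> //.
- by move=> x f'x; apply: mf; rewrite -f'E f'x linear0.
- move=> z'; have [y gy] := eg (u z').
  have /kvg[y' iy'] : (v \o g)%VF y = 0 by rewrite comp_lfunE gy (ses_comp0 _ uv).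
  by exists y'; apply: (inj_of_mono mu); rewrite g'E comp_lfunE iy' gy.
move=> y'; split=> [g'y | [x <-]].
  have /kfg[x fx] : g (i y') = 0 by rewrite -comp_lfunE -g'E g'y linear0.
  by exists x; apply: (inj_of_mono mi); rewrite f'E.
by apply: (inj_of_mono mu); rewrite g'E comp_lfunE f'E (ses_comp0 _ fg) linear0.
Qed.

Lemma ses_zero X : exists (Z : lmodule A) (f : 'Hom(Z, X)),
  (fullv : {vspace Z}) = 0%VS /\ ses f (\1%VF : 'Hom(X, X)).
Proof.
have [Z [f [hf mf ker]]] := kernel_exists (@hom_id _ _ X).
exists Z, f; split; last first.
  by split=> //; [exact: hom_id | move=> x; exists x; rewrite id_lfunE].
apply/vspaceP => z; rewrite memvf memv0.
have /ker : exists z', f z' = f z by exists z.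
by rewrite id_lfunE => /mf->; rewrite eqxx.
Qed.

Lemma filt1 C X : C X -> filt C X.
Proof.
move=> CX; have [Z [f [Z0 fs]]] := ses_zero X.
exact: filt_step fs (filt0 _ Z0) CX.
Qed.

Lemma filteredBy_filt C V (U : {vspace V}) : filteredBy C U ->
  forall Y (f : 'Hom(Y, V)), isLHom f -> mono f -> limg f = U -> filt C Y.
Proof.
move=> [n [F [F0 Fn sF FC]]] Y f hf mf fU.
suff filtF m : (m <= n)%N -> forall Y (f : 'Hom(Y, V)),
    isLHom f -> mono f -> limg f = F m -> filt C Y.
  by apply: (filtF n) hf mf _; rewrite ?fU.
elim: m => [|m IH] lemn {hf mf fU} {Y f} Y f hf mf fE.
  apply: filt0; apply/eqP; rewrite -(eq_limg_ker0 _ _ (mono_ker mf)) limg0.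
  by rewrite fE F0.
have [sFF [X CX [h [hlin hF hker]]]] := FC m lemn.
have [Y' [f' [hf' mf' f'E]]] := submodule_exists (sF m (ltnW lemn)).
have [|i [hi iE]] := factor_mono hf hf' mf.
  by move=> y; apply/memv_limg; rewrite fE (subvP sFF) // -f'E memv_img ?memvf.
have fF y : f y \in F m.+1 by rewrite -fE memv_img ?memvf.
apply: (@filt_step C Y' Y X i (h \o f)%VF _ _ CX); last first.
  exact: IH (ltnW lemn) _ f' hf' mf' f'E.
split=> //.
- by move=> a y; rewrite !comp_lfunE hf hlin.
- by move=> y iy; apply: mf'; rewrite -iE iy linear0.
- by apply/epiP; rewrite limg_comp fE.
move=> y; rewrite comp_lfunE; split=> [hfy | [y' <-]].
  have : f y \in F m by rewrite -hker memv_cap fF memv_ker hfy eqxx.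
  rewrite -f'E => /memv_limg[y' f'y']; exists y'; apply: (inj_of_mono mf).
  by rewrite iE.
have : f' y' \in F m by rewrite -f'E memv_img ?memvf.
by rewrite -hker memv_cap memv_ker iE => /andP[_ /eqP].
Qed.

Lemma filt_filteredBy C V Y (f : 'Hom(Y, V)) : isLHom f -> mono f ->
  filt C Y -> filteredBy C (limg f).
Proof.
move=> hf mf fY; elim: fY f hf mf => {Y} [Y Y0 | X Y Z i g fg _ IH CZ] f hf mf.
  exists 0%N, (fun=> 0%VS); rewrite Y0 limg0; split=> // t _ a x.
  by rewrite !memv0 => /eqP->; rewrite linear0.
have [hi hg mi eg ker] := fg.
have [||n [F [F0 Fn sF FC]]] := IH (f \o i)%VF; first exact: hom_comp.
  by move=> x; rewrite comp_lfunE => /mf/mi.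
exists n.+1, (fun t => if (t <= n)%N then F t else limg f).
split=> [//||t _|t]; first by rewrite ltnn.
  by case: ifP => [/sF//|_]; apply: limg_sub hf (@full_sub _ _ Y).
rewrite ltnS => letn; rewrite letn; have [lttn|] := ltnP t n; first exact: FC.
move=> lent; have -> : t = n by apply/eqP; rewrite eqn_leq letn.
rewrite Fn limg_comp; split; first by rewrite limgS ?subvf.
have fK := lker0_lfunK (mono_ker mf).
(* [f^-1] inverts [f] on its image and is defined on all of [V], as [subquotient_iso] demands. *)
exists Z => //; exists (g \o f^-1)%VF; split.
- move=> a _ /memv_limg[y <-]; rewrite -hf !comp_lfunE !fK; exact: hg.
- apply/vspaceP => z; rewrite memvf; have [y <-] := eg z.
  apply/memv_imgP; exists (f y); first by rewrite memv_img ?memvf.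
  by rewrite comp_lfunE fK.
apply/vspaceP => v; rewrite memv_cap memv_ker comp_lfunE.
apply/andP/memv_imgP => [[/memv_limg[y <-] /eqP] | [y /memv_limg[x <-] ->]].
  by rewrite fK => /ker[x <-]; exists (i x); rewrite ?memv_img ?memvf.
by rewrite memv_img ?memvf // fK (ses_comp0 _ fg) eqxx.
Qed.

Lemma filteredBy_full C V : filteredBy C (fullv : {vspace V}) <-> filt C V.
Proof.
split=> [fV | /(filt_filteredBy (@hom_id _ _ V))].
  apply: (filteredBy_filt fV (@hom_id _ _ V)); last by rewrite lim1g.
  by move=> x; rewrite id_lfunE.
by rewrite lim1g; apply=> x; rewrite id_lfunE.
Qed.

End Filtrations.

(** * Standard modules *)

Section Endomorphisms.
Variables (k : fieldType) (A : falgType k).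
Implicit Types X Y : lmodule A.

Definition endo_scalar X : Prop :=
  (exists x : X, x != 0)
  /\ forall f : 'End(X), isLHom f -> exists c : k, forall x, f x = c *: x.

(** Linearity and [phi 1 = id] force [phi] to be scalar multiplication; it is injective exactly when
    [X] is nonzero. *)
Lemma endo_is_kP X : endo_is_k X <-> endo_scalar X.
Proof.
split=> [[phi [phil phi1 phiM phiI phiH]] | [[x0 nx0] scal]].
  pose philin := GRing.isLinear.Build k k^o 'End(X) *:%R phi phil.
  pose phiL : {linear k^o -> 'End(X)} := HB.pack phi philin.
  have phiE c x : phi c x = c *: x.
    have -> : phi c = c *: phi 1.
      by have := linearZ_LR phiL c (1 : k^o); rewrite /= /GRing.scale /= mulr1.
    by rewrite phi1 scale_lfunE id_lfunE.
  split; last by move=> f /phiH[c <-]; exists c => x.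
  have /eqP/lfunPn[x] : phi 1 <> phi 0 by move/phiI/eqP; rewrite oner_eq0.
  by rewrite !phiE scale1r scale0r; exists x.
exists (fun c : k^o => c *: \1%VF); split.
- by move=> c a b; rewrite scalerDl scalerA.
- by rewrite scale1r.
- by move=> c d; rewrite -comp_lfunZl comp_lfun1l scalerA.
- move=> c d /lfunP/(_ x0); rewrite !scale_lfunE id_lfunE => /eqP.
  by rewrite -subr_eq0 -scalerBl scaler_eq0 (negPf nx0) orbF subr_eq0 => /eqP.
move=> f; split=> [/scal[c fE] | [c <-] a x].
  by exists c; apply/lfunP => x; rewrite scale_lfunE id_lfunE.
by rewrite !scale_lfunE !id_lfunE linearZ.
Qed.

Lemma endo_scalar_iso X Y (h : 'Hom(X, Y)) : isLHom h -> bijective h ->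
  endo_scalar X -> endo_scalar Y.
Proof.
move=> hh /bij_lfun[mh eh] [[x nx] scal]; split.
  by exists (h x); apply: contra nx => /eqP/mh->.
have [h' [hh' hK h'K]] := hom_inv hh mh eh.
move=> f hf; have [c cE] := scal _ (hom_comp hh' (hom_comp hf hh)).
exists c => y; apply: (inj_of_mono (f := h')); first exact: inj_mono (can_inj h'K).
by have := cE (h' y); rewrite !comp_lfunE h'K linearZ.
Qed.

End Endomorphisms.

(** * Standard modules as largest small quotients *)

Section Standard.
Variables (k : fieldType) (A : falgType k).
Variables (I : Type) (S : I -> lmodule A) (le : I -> I -> Prop).
Implicit Types (X Y Z P Q V : lmodule A) (i j : I).

(** [Hom(P(L), Z) = 0] detects that the simple [L] is not a composition factor of [Z], so this
    bounds the labels of the composition factors by [i]. *)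
Definition small i Z : Prop :=
  forall j Q (q : 'Hom(Q, S j)) (f : 'Hom(Q, Z)),
    ~ le j i -> isProjCover q -> isLHom f -> f = 0.

(** The last clause makes [X] the largest small quotient of [P]; for projective [P] it agrees with
    the quotient by the trace. *)
Definition standard_map i P X (d : 'Hom(P, X)) : Prop :=
  [/\ isLHom d, epi d, small i X
    & forall Z (f : 'Hom(P, Z)), small i Z -> isLHom f ->
        forall x, d x = 0 -> f x = 0].

Definition std i X : Prop :=
  exists P (p : 'Hom(P, S i)) (d : 'Hom(P, X)),
    isProjCover p /\ standard_map i d.

Lemma trace_sub i P K : isSumOf (traceFamily S le i (P := P)) K -> isSubmodule K.
Proof.
move=> sumK a x xK.
(* Stability of [K] under [a] becomes an inclusion in a preimage, which can be tested on each member
   of the family. *)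
have sKK : (K <= linfun (lact a : P -> P) @^-1: K)%VS.
  apply: (isSumOf_sub sumK) => U FU; apply/subvP => y yU.
  rewrite -memv_preim lfunE; apply: (subvP (isSumOf_sup sumK FU)).
  have [j [Q [q [f [_ _ hf eU]]]]] := FU.
  by move: yU; rewrite eU; apply: limg_sub hf (@full_sub _ _ Q) a y.
by have := subvP sKK _ xK; rewrite -memv_preim lfunE.
Qed.

(** A map from [P(L')] to the quotient lifts to [P], where its image lies in the trace; so the
    quotient is small. Conversely a map from [P] to a small module kills every member of the trace
    family. *)
Lemma trace_standard i P X (d : 'Hom(P, X)) : isLHom d -> epi d ->
  isSumOf (traceFamily S le i (P := P)) (lker d) -> standard_map i d.
Proof.
move=> hd ed sumd; split=> // [j Q q f nji cq hf | Z f sZ hf x dx].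
  have [h [hh dh]] := proj_lift (cover_proj cq) hd ed hf.
  have /(isSumOf_sup sumd)/subvP hd0 : traceFamily S le i (limg h).
    by exists j, Q, q, h.
  apply/lfunP => y; rewrite zero_lfunE -dh; apply/eqP.
  by rewrite -memv_ker hd0 // memv_img ?memvf.
apply/eqP; rewrite -memv_ker; apply: (subvP (isSumOf_sub sumd _)).
  move=> _ [j [Q [q [g [nji cq hg ->]]]]]; rewrite lkerE -limg_comp.
  by rewrite (sZ j Q q _ nji cq (hom_comp hf hg)) lim0g.
by rewrite memv_ker dx.
Qed.

(** The quotient by the trace is also a largest small quotient, and two such quotients have the same
    kernel. *)
Lemma standard_trace i P X (d : 'Hom(P, X)) : standard_map i d ->
  isSumOf (traceFamily S le i (P := P)) (lker d).
Proof.
move=> [hd ed sX univ].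
have [K sumK] := isSumOf_exists (traceFamily S le i (P := P)).
have [Y [g [hg eg gK]]] := quotient_exists (trace_sub sumK).
suff -> : lker d = K by [].
have [_ _ sY _] : standard_map i g by apply: trace_standard => //; rewrite gK.
apply/eqP; rewrite eqEsubv; apply/andP; split.
  by apply/subvP => x; rewrite -gK !memv_ker => /eqP/(univ _ _ sY hg)->.
apply: (isSumOf_sub sumK) => _ [j [Q [q [f [nji cq hf ->]]]]].
by rewrite lkerE -limg_comp (sX j Q q _ nji cq (hom_comp hd hf)) lim0g.
Qed.

Lemma isStandardP i X : isStandard S le i X <-> std i X.
Proof.
split=> [[P [p [d [cp hd /epiP ed sumd]]]] | [P [p [d [cp sd]]]]].
  by exists P, p, d; split=> //; apply: trace_standard.
exists P, p, d; have [hd /epiP ed _ _] := sd; split=> //.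
exact: standard_trace.
Qed.

Lemma standard_map_exists i P : exists X (d : 'Hom(P, X)), standard_map i d.
Proof.
have [K sumK] := isSumOf_exists (traceFamily S le i (P := P)).
have [Y [g [hg eg gK]]] := quotient_exists (trace_sub sumK).
by exists Y, g; apply: trace_standard => //; rewrite gK.
Qed.

Lemma std_exists i : isSimple (S i) -> exists X, std i X.
Proof.
move/simple_cover_exists=> [P [p cp]].
by have [X [d sd]] := standard_map_exists i P; exists X, P, p, d.
Qed.

Lemma small_mono i X Y (f : 'Hom(X, Y)) :
  isLHom f -> mono f -> small i Y -> small i X.
Proof.
move=> hf mf sY j Q q g nji cq hg; apply/lfunP => x; rewrite zero_lfunE.
apply: mf; rewrite -comp_lfunE (sY j Q q _ nji cq (hom_comp hf hg)).
by rewrite zero_lfunE.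
Qed.

Lemma standard_map_iso i P P' X X' (h : 'Hom(P', P)) (d : 'Hom(P, X))
    (u : 'Hom(X, X')) : isLHom h -> bijective h -> isLHom u -> bijective u ->
  standard_map i d -> standard_map i (u \o (d \o h))%VF.
Proof.
move=> hh /bij_lfun[mh eh] hu /bij_lfun[mu eu] [hd ed sX univ].
have [u' [hu' uK u'K]] := hom_inv hu mu eu.
have [h' [hh' hK h'K]] := hom_inv hh mh eh.
split.
- by do 2?apply: hom_comp.
- move=> y; have [x <-] := eu y; have [z <-] := ed x; have [w <-] := eh z.
  by exists w; rewrite !comp_lfunE.
- exact: small_mono hu' (inj_mono (can_inj u'K)) sX.
move=> Z f sZ hf x; rewrite !comp_lfunE => /mu dhx.
by have := univ _ _ sZ (hom_comp hf hh') _ dhx; rewrite comp_lfunE hK.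
Qed.

Lemma std_cover i X P (p : 'Hom(P, S i)) : std i X -> isProjCover p ->
  exists d : 'Hom(P, X), standard_map i d.
Proof.
move=> [P0 [p0 [d0 [cp0 sd0]]]] cp.
have [h [hh bh _]] := cover_iso_id cp cp0.
exists (\1 \o (d0 \o h))%VF; apply: standard_map_iso => //.
  exact: hom_id.
by exists id => x; rewrite id_lfunE.
Qed.

Lemma std_iso i X Y (h : 'Hom(X, Y)) : isLHom h -> bijective h ->
  std i X -> std i Y.
Proof.
move=> hh bh [P [p [d [cp sd]]]]; exists P, p, (h \o (d \o \1))%VF.
split=> //; apply: standard_map_iso => //; first exact: hom_id.
by exists id => x; rewrite id_lfunE.
Qed.

Lemma std_unique i X Y : std i X -> std i Y ->
  exists h : 'Hom(X, Y), isLHom h /\ bijective h.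
Proof.
move=> [P [p [d [cp sd]]]] sY; have [e se] := std_cover sY cp.
have [hd ed sX ud] := sd; have [he ee sY' ue] := se.
have [h [hh hE]] := factor_epi hd he ed (ud _ _ sY' he).
exists h; split=> //; apply/bij_lfun; split.
  by move=> x; have [z <-] := ed x; rewrite hE => /(ue _ _ sX hd).
by move=> y; have [z <-] := ee y; exists (d z).
Qed.

Definition above i Z : Prop := exists j, [/\ le i j, i <> j & std j Z].

Lemma qh_endo i X : quasiHereditary S le -> std i X -> endo_scalar X.
Proof. by case=> _ _ endo _ /isStandardP/endo/endo_is_kP. Qed.

Lemma qh_kernel i P (p : 'Hom(P, S i)) X (d : 'Hom(P, X)) Y (f : 'Hom(Y, P)) :
  quasiHereditary S le -> isProjCover p -> standard_map i d -> ses f d ->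
  filt (above i) Y.
Proof.
case=> _ _ _ fil cp sd [hf hd mf _ ker].
have fE : limg f = lker d.
  by apply/vspaceP => x; rewrite memv_ker; apply/idP/eqP; rewrite memv_limg ker.
have := filteredBy_filt (fil i P p _ cp (standard_trace sd)) hf mf fE.
by apply: filtW => Z [j [leij nij /isStandardP sZ]]; exists j.
Qed.

(** Projective covers of a simple module are isomorphic, so one cover per label suffices for the
    kernel condition. *)
Lemma qh_intro : isSim S -> Relation_Definitions.order I le ->
  (forall i X, std i X -> endo_scalar X) ->
  (forall i, exists P (p : 'Hom(P, S i)) X (d : 'Hom(P, X)) Y (f : 'Hom(Y, P)),
    [/\ isProjCover p, standard_map i d, ses f d & filt (above i) Y]) ->
  quasiHereditary S le.
Proof.
move=> simS ordle endo fil; split=> //.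
  by move=> i X /isStandardP/endo/endo_is_kP.
move=> i P p K cp sumK.
have [P0 [p0 [X [d [Y [f [cp0 sd fd fY]]]]]]] := fil i.
have [h [hh bh _]] := cover_iso_id cp0 cp.
have /bij_lfun[mh eh] := bh.
have [h' [hh' hK h'K]] := hom_inv hh mh eh.
have bh' : bijective h' by exists h.
have sdh : standard_map i (\1 \o (d \o h'))%VF.
  apply: standard_map_iso => //; first exact: hom_id.
  by exists id => x; rewrite id_lfunE.
have [hf hd mf ed ker] := fd.
have -> : K = limg (h \o f)%VF.
  apply/vspaceP => x; have -> : (x \in K) = (x \in lker (\1 \o (d \o h'))%VF).
    have sumd := standard_trace sdh.
    by apply/idP/idP => [/sumK/sumd | /sumd/sumK].
  rewrite memv_ker !comp_lfunE id_lfunE.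
  apply/eqP/idP => [/ker[y fy] | /memv_limg[y <-]].
    by apply/memv_limg; exists y; rewrite comp_lfunE fy h'K.
  by rewrite comp_lfunE hK (ses_comp0 _ fd).
apply: filt_filteredBy; first exact: hom_comp.
  by move=> y; rewrite comp_lfunE => /mh/mf.
by apply: filtW fY => Z [j [leij nij /isStandardP sZ]]; exists j.
Qed.

(** * Direct summands of standardly filtered modules *)

Section Summands.
Hypothesis qh : quasiHereditary S le.

Let antisym i j : le i j -> le j i -> i = j.
Proof. by case: qh => _ [_ _ anti] _ _; apply: anti. Qed.

Let trans i j l : le i j -> le j l -> le i l.
Proof. by case: qh => _ [_ tr _] _ _; apply: tr. Qed.

Lemma std_hom_le i j X Y (f : 'Hom(X, Y)) :
  std i X -> std j Y -> isLHom f -> f != 0 -> le i j.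
Proof.
move=> [P [p [d [cp [hd ed _ _]]]]] [_ [_ [_ [_ [_ _ sY _]]]]] hf nf.
apply: NNPP => nij; case/eqP: nf; apply/lfunP => x; have [z <-] := ed x.
by rewrite -comp_lfunE (sY i P p _ nij cp (hom_comp hf hd)) !zero_lfunE.
Qed.

(** Composing with an isomorphism back to [X] gives a nonzero endomorphism, which is an invertible
    scalar. *)
Lemma std_hom_bij i X Y (f : 'Hom(X, Y)) :
  std i X -> std i Y -> isLHom f -> f != 0 -> bijective f.
Proof.
move=> sX sY hf /lfun_neq0[x nfx].
have [h [hh /bij_lfun[mh eh]]] := std_unique sY sX.
have [_ scal] := qh_endo qh sX.
have [c cE] := scal _ (hom_comp hh hf).
have nc : c != 0.
  apply: contra nfx => /eqP c0; apply/eqP/mh.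
  by rewrite -comp_lfunE cE c0 scale0r.
apply/bij_lfun; split=> [y fy | y].
  have := cE y; rewrite comp_lfunE fy linear0 => /esym/eqP.
  by rewrite scaler_eq0 (negPf nc) => /eqP.
exists (c^-1 *: h y); apply: (inj_of_mono mh).
by rewrite -comp_lfunE cE scalerA divff // scale1r.
Qed.

Definition below i Z : Prop := exists2 j, ~ (le i j /\ i <> j) & std j Z.

Lemma filt_hom_zero (C : lmodule A -> Prop) X Y (f : 'Hom(X, Y)) : filt C X ->
  (forall Z (g : 'Hom(Z, Y)), C Z -> isLHom g -> g = 0) -> isLHom f -> f = 0.
Proof.
move=> fX; elim: fX Y f => {X} [X X0 | X V Z u v uv _ IH CZ] Y f C0 hf.
  by apply/lfunP => x; rewrite (zero_eq x X0) !linear0.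
have [hu hv mu ev ker] := uv.
have fu := IH _ _ C0 (hom_comp hf hu).
have [x /ker[y <-]|g [hg gE]] := factor_epi hv hf ev.
  by rewrite -comp_lfunE fu zero_lfunE.
by apply/lfunP => x; rewrite -gE (C0 _ _ CZ hg) !zero_lfunE.
Qed.

Lemma filt_zero_hom (C : lmodule A -> Prop) X Y (f : 'Hom(X, Y)) : filt C Y ->
  (forall Z (g : 'Hom(X, Z)), C Z -> isLHom g -> g = 0) -> isLHom f -> f = 0.
Proof.
move=> fY; elim: fY X f => {Y} [Y Y0 | Y V Z u v uv _ IH CZ] X f C0 hf.
  by apply/lfunP => x; rewrite zero_lfunE; apply: zero_eq.
have [hu hv mu ev ker] := uv.
have vf := C0 _ _ CZ (hom_comp hv hf).
have [x|g [hg gE]] := factor_mono hu hf mu.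
  by apply/ker; rewrite -comp_lfunE vf zero_lfunE.
by apply/lfunP => x; rewrite -gE (IH _ _ C0 hg) !zero_lfunE linear0.
Qed.

(* [Ext^1(std i, X) = 0]: a surjection onto [std i] lifts to the projective
   cover, whose standard kernel is filtered by labels above [i] and so admits
   no nonzero map to [X]. *)
Lemma std_split i X Y Z (f : 'Hom(X, Y)) (g : 'Hom(Y, Z)) : ses f g ->
  filt (below i) X -> std i Z ->
  exists s : 'Hom(Z, Y), isLHom s /\ forall z, g (s z) = z.
Proof.
move=> [hf hg mf eg ker] fX [P [p [d [cp sd]]]].
have [hd ed _ _] := sd.
have [h [hh gh]] := proj_lift (cover_proj cp) hg eg hd.
have [K [u [hu mu keru]]] := kernel_exists hd.
have fK : filt (above i) K by apply: (qh_kernel (f := u) qh cp sd).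
have [x|w [hw wE]] := factor_mono hf (hom_comp hh hu) mf.
  by apply/ker; rewrite comp_lfunE gh; apply/keru; exists x.
have w0 : w = 0.
  (* A nonzero map from a layer of [K], with label above [i], to a layer of [X] would put the
     latter's label above [i] too. *)
  apply: filt_hom_zero fK _ hw => W v [j [leij nij sW]] hv.
  apply: filt_zero_hom fX _ hv => W' v' [l nl sW'] hv'.
  apply/eqP; apply: contra_notT nl => nv'.
  have lejl := std_hom_le sW sW' hv' nv'; split; first exact: trans lejl.
  by move=> il; apply: nij; apply: antisym => //; rewrite il.
have [x /keru[y <-]|s [hs sE]] := factor_epi hd hh ed.
  by rewrite -comp_lfunE -wE w0 zero_lfunE linear0.
by exists s; split=> // z; have [x <-] := ed z; rewrite sE gh.
Qed.

Definition stdfilt : lmodule A -> Prop := filt (fun Z => exists i, std i Z).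

(** Adding a top layer with label [j] to [X] keeps the maximal label [i] of [X] unless [j] is
    strictly above [i]. In that case [j] is maximal for all of [V], and the layer embeds in [V]
    because the extension splits. *)
Lemma stdfilt_maximal V : stdfilt V -> (fullv : {vspace V}) <> 0%VS ->
  exists i X (f : 'Hom(X, V)), [/\ std i X, isLHom f, f != 0 & filt (below i) V].
Proof.
elim=> {V} [V V0 // | X V Z u v uv fX IH [j sZ] _].
have [hu hv mu ev ker] := uv.
have fbelow i : filt (below i) X -> ~ (le i j /\ i <> j) -> filt (below i) V.
  by move=> fXi nij; apply: filt_step uv fXi _; exists j.
have top : filt (below j) X -> exists i X (f : 'Hom(X, V)),
    [/\ std i X, isLHom f, f != 0 & filt (below i) V].
  move=> fXj; have [s [hs vs]] := std_split uv fXj sZ.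
  exists j, Z, s; split=> //; last by apply: fbelow => // -[_].
  apply/lfunPn; have [[z nz] _] := qh_endo qh sZ; exists z.
  by rewrite zero_lfunE; apply: contra nz => /eqP sz; rewrite -(vs z) sz linear0.
have [X0|nX] := eqVneq (fullv : {vspace X}) 0%VS; first exact/top/filt0.
have [i [Y [f [sY hf nf fXi]]]] := IH (elimN eqP nX).
have [[leij nij]|nij] := classic (le i j /\ i <> j).
  apply: top; apply: filtW fXi => W [l nl sW]; exists l => // -[lejl njl].
  apply: nl; split; first exact: trans lejl.
  by move=> il; apply: nij; apply: antisym => //; rewrite il.
exists i, Y, (u \o f)%VF; split=> //; [exact: hom_comp | | exact: fbelow].
have [y nfy] := lfun_neq0 nf; apply/lfunPn; exists y.
by rewrite comp_lfunE zero_lfunE; apply: contra nfy => /eqP/mu->.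
Qed.

(* The maximality of [i] makes every nonzero composite [std i -> V -> std j] a
   splitting, so a nonzero [f] is the inclusion of a filtration layer. *)
Lemma stdfilt_coker i X V (f : 'Hom(X, V)) : filt (below i) V ->
  std i X -> isLHom f -> f != 0 ->
  mono f /\ forall (W : lmodule A) (c : 'Hom(V, W)), isLHom c -> epi c ->
    (forall y, c y = 0 <-> exists x, f x = y) -> stdfilt W.
Proof.
move=> fV sX; elim: fV f => {V} [V V0 | V' V Z u v uv fV' IH [j nij sZ]] f hf nf.
  by case/lfun_neq0: nf => x; rewrite (zero_eq (f x) V0) eqxx.
have [hu hv mu ev ker] := uv.
(* If [v \o f] vanishes, [f] comes from a map to [V'], whose cokernel [W'] is filtered by induction;
   then [W] is an extension of [Z] by [W']. *)
have [vf0|nvf] := eqVneq (v \o f)%VF 0.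
  have [x|f' [hf' f'E]] := factor_mono hu hf mu.
    by apply/ker; rewrite -comp_lfunE vf0 zero_lfunE.
  have nf' : f' != 0.
    have [x nfx] := lfun_neq0 nf; apply/lfunPn; exists x.
    by rewrite zero_lfunE; apply: contra nfx => /eqP f'x; rewrite -f'E f'x linear0.
  have [mf' filW] := IH f' hf' nf'.
  split=> [x fx | W c hc ec kerc].
    by apply: mf'; apply: (inj_of_mono mu); rewrite f'E fx linear0.
  have [W' [c' [hc' ec' kerc']]] := cokernel_exists hf'.
  have [x /kerc'[y <-]|a [ha aE]] := factor_epi hc' (hom_comp hc hu) ec'.
    by rewrite comp_lfunE f'E; apply/kerc; exists y.
  have [x /kerc[y <-]|b [hb bE]] := factor_epi hc hv ec.
    by rewrite -f'E (ses_comp0 _ uv).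
  have fW' : stdfilt W' by apply: filW kerc'.
  apply: (filt_step _ fW'); last by exists j; exact: sZ.
  split; [exact: ha | exact: hb | | |].
  - move=> w'; have [x <-] := ec' w'; rewrite aE comp_lfunE => /kerc[y fy].
    by apply/kerc'; exists y; apply: (inj_of_mono mu); rewrite f'E.
  - by move=> z; have [y <-] := ev z; exists (c y).
  move=> w; have [y <-] := ec w; rewrite bE ker; split=> [[x <-]|[w' aw]].
    by exists (c' x); rewrite aE comp_lfunE.
  have [x cx] := ec' w'; have /kerc[z fz] : c (y - u x) = 0.
    by rewrite linearB /= -aw -cx aE comp_lfunE subrr.
  by exists (x + f' z); rewrite linearD /= f'E fz addrC subrK.
(* Otherwise [i] is at most [j], and [j] is not strictly above [i], so the labels coincide and
   [v \o f] is an isomorphism. The image of [f] is then a complement of [V'], and [W] is a copy of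
   [V']. *)
have leij : le i j by apply: std_hom_le sX sZ (hom_comp hv hf) nvf.
have eij : i = j by apply: NNPP => nij'; apply: nij.
rewrite -eij in sZ.
have /bij_lfun[mvf evf] := std_hom_bij sX sZ (hom_comp hv hf) nvf.
split=> [x fx | W c hc ec kerc].
  by apply: mvf; rewrite comp_lfunE fx linear0.
apply: (filt_iso (hom_comp hc hu)); last by apply: filtW fV' => Y [l _ sY]; exists l.
apply/bij_lfun; split=> [x | w].
  rewrite comp_lfunE => /kerc[y fy]; apply: mu; rewrite -fy.
  by rewrite (mvf y) ?linear0 // comp_lfunE fy (ses_comp0 _ uv).
have [y <-] := ec w; have [x vfx] := evf (v y).
have /ker[t ut] : v (y - f x) = 0.
  by rewrite linearB /= -vfx comp_lfunE subrr.
exists t; rewrite comp_lfunE ut linearB /=.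
by have -> : c (f x) = 0; rewrite ?subr0 //; apply/kerc; exists x.
Qed.

(** Induction on the dimension of [V], with [f] a nonzero map from a standard module of maximal
    label. If [w \o f = 0], then [U] is a retract of the cokernel of [f]. If not, [f] is replaced by
    [u \o w \o f], which lands in the summand: its cokernel retracts onto the cokernel [U'] of
    [w \o f], and [U] is an extension of [U'] by the standard module. *)
Lemma stdfilt_retract (U V : lmodule A) (u : 'Hom(U, V)) (w : 'Hom(V, U)) : stdfilt V ->
  isLHom u -> isLHom w -> (forall x, w (u x) = x) -> stdfilt U.
Proof.
have [n] := ubnP (\dim {:V}); elim: n U V u w => // n IH U V u w ltVn fV hu hw wu.
have [U0|/eqP nU] := eqVneq (fullv : {vspace U}) 0%VS; first exact: filt0.
have nV : (fullv : {vspace V}) <> 0%VS.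
  move=> V0; apply: nU; apply/vspaceP => x.
  by rewrite memvf memv0 -(wu x) (zero_eq (u x) V0) linear0 eqxx.
have [i [X [f [sX hf nf fVi]]]] := stdfilt_maximal fV nV.
have mu : mono u by move=> x ux; rewrite -(wu x) ux linear0.
have smaller (g : 'Hom(X, V)) : isLHom g -> g != 0 ->
    exists (W : lmodule A) (c : 'Hom(V, W)),
    [/\ isLHom c, epi c, forall y, c y = 0 <-> exists x : X, g x = y
      & mono g /\ forall (U' : lmodule A) (u' : 'Hom(U', W)) (w' : 'Hom(W, U')),
          isLHom u' ->
          isLHom w' -> (forall x, w' (u' x) = x) -> stdfilt U'].
  move=> hg ng; have [mg cokg] := stdfilt_coker fVi sX hg ng.
  have [W [c [hc ec kerc]]] := cokernel_exists hg.
  exists W, c; split=> //; split=> // U' u' w' hu' hw' wu'.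
  apply: (IH _ _ u' w') => //; last exact: cokg kerc.
  apply: leq_trans _ (ltVn : (_ <= n)%N); rewrite ltnNge; apply/negP => leVW.
  have [x ngx] := lfun_neq0 ng; case/negP: ngx; apply/eqP.
  by apply: (epi_mono ec leVW); apply/kerc; exists x.
have hwf := hom_comp hw hf.
have [wf0|nwf] := eqVneq (w \o f)%VF 0.
  have [W [c [hc ec kerc [_ fin]]]] := smaller f hf nf.
  have [x /kerc[y <-]|w' [hw' wE]] := factor_epi hc hw ec.
    by rewrite -comp_lfunE wf0 zero_lfunE.
  apply: (fin U (c \o u)%VF w') => //; first exact: hom_comp.
  by move=> x; rewrite comp_lfunE wE wu.
have ng : (u \o (w \o f))%VF != 0.
  have [x nx] := lfun_neq0 nwf; apply/lfunPn; exists x.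
  by rewrite comp_lfunE zero_lfunE; apply: contra nx => /eqP/mu->.
have [W [c [hc ec kerc [mg fin]]]] := smaller _ (hom_comp hu hwf) ng.
have [U' [c' [hc' ec' kerc']]] := cokernel_exists hwf.
have [x /kerc'[y <-]|u' [hu' uE]] := factor_epi hc' (hom_comp hc hu) ec'.
  by rewrite comp_lfunE; apply/kerc; exists y; rewrite comp_lfunE.
have [x /kerc[y <-]|w' [hw' wE]] := factor_epi hc (hom_comp hc' hw) ec.
  by rewrite comp_lfunE comp_lfunE wu; apply/kerc'; exists y.
have fU' : stdfilt U'.
  apply: (fin U' u' w') => // z; have [x <-] := ec' z.
  by rewrite uE comp_lfunE wE comp_lfunE wu.
apply: (filt_ext _ (filt1 (ex_intro _ i sX)) fU'); split; last exact: kerc'.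
- exact: hwf.
- exact: hc'.
- by move=> x wfx; apply: mg; rewrite comp_lfunE wfx linear0.
- exact: ec'.
Qed.

End Summands.
End Standard.

(** * Modules over triangular rings *)

Section Bimodules.
Variables (k : fieldType) (A B : falgType k) (M : bimodule A B).

Lemma bactDl (x y : M) b : bact (x + y) b = bact x b + bact y b.
Proof. by have := bact_linl b 1 x y; rewrite !scale1r. Qed.

Lemma bactDr (x : M) b c : bact x (b + c) = bact x b + bact x c.
Proof. by have := bact_linr x 1 b c; rewrite !scale1r. Qed.

Lemma bact0l b : bact (0 : M) b = 0.
Proof. by apply: (addrI (bact 0 b)); rewrite -bactDl !addr0. Qed.

Lemma bact0r (x : M) : bact x 0 = 0.
Proof. by apply: (addrI (bact x 0)); rewrite -bactDr !addr0. Qed.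

End Bimodules.

(* A module on which [s 1] acts as the identity, for a multiplicative but not
   necessarily unital [s : A' -> A]. *)
Section Corner.
Variables (k : fieldType) (A A' : falgType k) (s : A' -> A) (X : lmodule A).
Hypotheses (s_lin : linear s) (sM : forall a b, s (a * b) = s a * s b).
Hypothesis s1 : forall x : X, lact (s 1) x = x.
Let act (a : A') (x : X) := lact (s a) x.
Fact corner_linl x : linear (act^~ x).
Proof. by move=> c a b; rewrite /act s_lin lactDl lactZl. Qed.
Fact corner_linr a : linear (act a).
Proof. exact: lact_linr. Qed.
Fact corner_actM a b x : act (a * b) x = act a (act b x).
Proof. by rewrite /act sM lactM. Qed.
Definition corner := LModule corner_linl corner_linr s1 corner_actM.
End Corner.

Section Triangular.
Variables (k : fieldType) (A2 A1 : falgType k) (M : bimodule A2 A1).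
Notation A := (tri M).
Notation infl1 X := (lrestr (@tri11 k A2 A1 M) X).
Notation infl2 X := (lrestr (@tri22 k A2 A1 M) X).
Implicit Types Z P : lmodule A.

Definition e2 : A := Tri 1 0 0.
Definition e1 : A := Tri 0 0 1.
Definition inj2 (a : A2) : A := Tri a 0 0.
Definition inj1 (b : A1) : A := Tri 0 0 b.

Lemma TriM a m b a' m' b' : (Tri a m b : A) * Tri a' m' b' =
  Tri (a * a') (lact a m' + bact m b') (b * b').
Proof. by []. Qed.

Lemma inj2_lin : linear inj2.
Proof.
by move=> c a b; congr (_, _, _); rewrite /= ?scaler0 ?addr0.
Qed.

Lemma inj1_lin : linear inj1.
Proof.
by move=> c a b; congr (_, _, _); rewrite /= ?scaler0 ?addr0.
Qed.

Lemma inj2M a b : inj2 (a * b) = inj2 a * inj2 b.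
Proof. by rewrite TriM linear0 bact0r addr0 mulr0. Qed.

Lemma inj1M a b : inj1 (a * b) = inj1 a * inj1 b.
Proof. by rewrite TriM linear0 bact0l addr0 mulr0. Qed.

Lemma e2K : e2 * e2 = e2.
Proof. by have := inj2M 1 1; rewrite mulr1. Qed.

(** Through this identity [A] acts on [e2 Z] by way of [tri22]; [sub_inj1] does the same for [tri11]
    and [Z / e2 Z]. *)
Lemma mul_e2 (x : A) : x * e2 = inj2 (tri22 x) * e2.
Proof.
case: x => [[a m] b]; rewrite [LHS](TriM a m b 1 0 0) [RHS](TriM a 0 0 1 0 0).
by rewrite linear0 !bact0r !mulr0.
Qed.

Lemma sub_inj1 (x : A) : x = inj1 (tri11 x) + e2 * x.
Proof.
case: x => [[a m] b]; rewrite [e2 * _](TriM 1 0 0 a m b).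
rewrite lact1 bact0l mul1r mul0r addr0.
by congr (_, _, _); rewrite /= ?add0r ?addr0.
Qed.

Lemma e2_e1 (x : A) : e2 * x * e1 = Tri 0 (tri21 x) 0.
Proof.
case: x => [[a m] b]; rewrite [e2 * _](TriM 1 0 0 a m b) TriM.
by rewrite lact1 bact0l bact1 mul0r mulr0 mul0r linear0 !addr0 add0r.
Qed.

Lemma infl2_e2 (X : lmodule A2) (x : infl2 X) : lact e2 x = x.
Proof. exact: (@lact1 _ _ X). Qed.

Lemma infl1_e2 (X : lmodule A1) (x : infl1 X) : lact e2 x = 0.
Proof. exact: (@lact0l _ _ X). Qed.

Lemma hom_infl2 (X Y : lmodule A2) (f : 'Hom(X, Y)) :
  isLHom f <-> @isLHom _ A (infl2 X) (infl2 Y) f.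
Proof. by split=> hf a x; [exact: hf | exact: (hf (inj2 a) x)]. Qed.

Lemma hom_infl1 (X Y : lmodule A1) (f : 'Hom(X, Y)) :
  isLHom f <-> @isLHom _ A (infl1 X) (infl1 Y) f.
Proof. by split=> hf a x; [exact: hf | exact: (hf (inj1 a) x)]. Qed.

(** [e2 Z], and below it [Z / e2 Z], are specified by maps with the right image or kernel. They are
    the right and the left adjoint of inflation from [A2] and [A1], which is the content of
    [factor_part2] and [factor_part1]. *)
Definition is_part2 Z (Y : lmodule A2) (f : 'Hom(infl2 Y, Z)) : Prop :=
  [/\ isLHom f, mono f & forall z, lact e2 z = z <-> exists y, f y = z].

Definition is_part1 Z (Y : lmodule A1) (g : 'Hom(Z, infl1 Y)) : Prop :=
  [/\ isLHom g, epi g & forall z, g z = 0 <-> lact e2 z = z].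

Let U2 Z : {vspace Z} := limg (linfun (lact e2 : Z -> Z)).

Let mem_U2 Z (z : Z) : z \in U2 Z <-> lact e2 z = z.
Proof.
rewrite /U2; split=> [/memv_imgP[y _ ->] | <-].
  by rewrite lfunE /= -lactM e2K.
by apply/memv_imgP; exists z; rewrite ?memvf // lfunE.
Qed.

Let U2_sub Z : isSubmodule (U2 Z).
Proof.
move=> a z /mem_U2 zE; apply/mem_U2.
have -> : lact a z = lact (inj2 (tri22 a)) z.
  by rewrite -{1}zE -lactM mul_e2 lactM zE.
by rewrite -lactM -[e2]/(inj2 1) -inj2M mul1r.
Qed.

Lemma part2_exists Z : exists (Y : lmodule A2) (f : 'Hom(infl2 Y, Z)), is_part2 f.
Proof.
have [Z' [f [hf mf fE]]] := submodule_exists (@U2_sub Z).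
have e2Z' (z : Z') : lact (inj2 1) z = z.
  apply: (inj_of_mono mf); rewrite hf; apply/mem_U2.
  by rewrite -fE memv_img ?memvf.
exists (corner inj2_lin inj2M e2Z'), f; split=> //.
  move=> a z; rewrite -hf; congr (f _).
  by rewrite -[in RHS](e2Z' z) -lactM mul_e2 lactM e2Z'.
by move=> z; rewrite -mem_U2 -fE memv_limg.
Qed.

Lemma part1_exists Z : exists (Y : lmodule A1) (g : 'Hom(Z, infl1 Y)), is_part1 g.
Proof.
have [Z' [g [hg eg gE]]] := quotient_exists (@U2_sub Z).
have gU z : g z = 0 <-> lact e2 z = z.
  by rewrite -mem_U2 -gE memv_ker; split=> [->|/eqP].
have e2Z' (a : A) (z : Z') : lact (e2 * a) z = 0.
  by have [y <-] := eg z; rewrite -hg; apply/gU; rewrite -lactM mulrA e2K.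
have actE (x : A) (z : Z') : lact x z = lact (inj1 (tri11 x)) z.
  by rewrite {1}[x]sub_inj1 lactDl e2Z' addr0.
have e1Z' (z : Z') : lact (inj1 1) z = z by rewrite -[RHS]lact1 [RHS]actE.
exists (corner inj1_lin inj1M e1Z'), g; split=> // a z.
by rewrite hg actE.
Qed.

Lemma hom_infl2_e2 (X : lmodule A2) Z (f : 'Hom(infl2 X, Z)) x :
  isLHom f -> lact e2 (f x) = f x.
Proof. by move=> hf; rewrite -hf infl2_e2. Qed.

Lemma factor_part2 Z (Y : lmodule A2) (j : 'Hom(infl2 Y, Z)) (X : lmodule A2)
    (f : 'Hom(infl2 X, Z)) : is_part2 j -> isLHom f ->
  exists h : 'Hom(X, Y), isLHom h /\ forall x, j (h x) = f x.
Proof.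
move=> [hj mj jE] hf; have [|h [hh hE]] := factor_mono hj hf mj.
  by move=> x; apply/jE; apply: hom_infl2_e2 hf.
by exists h; split=> //; apply/hom_infl2.
Qed.

Lemma factor_part1 Z (Y : lmodule A1) (g : 'Hom(Z, infl1 Y)) (X : lmodule A1)
    (f : 'Hom(Z, infl1 X)) : is_part1 g -> isLHom f ->
  exists h : 'Hom(Y, X), isLHom h /\ forall x, h (g x) = f x.
Proof.
move=> [hg eg gE] hf; have [|h [hh hE]] := factor_epi hg hf eg.
  by move=> x /gE <-; rewrite hf infl1_e2.
by exists h; split=> //; apply/hom_infl1.
Qed.

(** Maps out of an inflated [A2]-module land in the [e2]-part of the target, and passing to
    [e2]-parts preserves surjections. *)
Lemma cover_infl2 (Q L : lmodule A2) (q : 'Hom(Q, L)) :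
  isProjCover q -> @isProjCover _ A (infl2 Q) (infl2 L) q.
Proof.
move=> [pQ hq eq ess]; split=> //; first last.
- by move=> U sU; apply: ess => a x; apply: (sU (inj2 a)).
- exact/hom_infl2.
move=> X Y g f hg /epiP eg hf.
have [X2 [i pi]] := part2_exists X; have [Y2 [j pj]] := part2_exists Y.
have [hi mi iE] := pi; have [hj mj jE] := pj.
have [g2 [hg2 g2E]] := factor_part2 pj (hom_comp hg hi).
have [f2 [hf2 f2E]] := factor_part2 pj hf.
have eg2 : epi g2.
  move=> y; have [z gz] := eg (j y).
  have /iE[x ix] : lact e2 (lact e2 z) = lact e2 z by rewrite -lactM e2K.
  exists x; apply: (inj_of_mono mj).
  by rewrite g2E comp_lfunE ix hg gz (hom_infl2_e2 _ hj).
have [h [hh g2h]] := proj_lift pQ hg2 eg2 hf2.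
exists (i \o (h : 'Hom(infl2 Q, infl2 X2)))%VF; split.
  by apply: hom_comp => //; apply/hom_infl2.
by apply/lfunP => x; rewrite !comp_lfunE -(comp_lfunE g) -g2E g2h.
Qed.

(** A left adjoint of the exact inflation functor preserves projectives; superfluity is pulled back
    along [g]. *)
Lemma cover_part1 P (P1 L : lmodule A1) (p : 'Hom(P, infl1 L))
    (g : 'Hom(P, infl1 P1)) : isProjCover p -> is_part1 g ->
  exists p1 : 'Hom(P1, L), isProjCover p1 /\ forall x, p1 (g x) = p x.
Proof.
move=> cp pg; have [hg eg gE] := pg.
have [p1 [hp1 p1E]] := factor_part1 pg (cover_hom cp).
exists p1; split=> //; split=> //.
- move=> X Y u f hu /epiP eu hf.
  have [h [hh uh]] := proj_lift (X := infl1 X) (Y := infl1 Y) (cover_proj cp)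
    (proj1 (hom_infl1 u) hu) eu (hom_comp (proj1 (hom_infl1 f) hf) hg).
  have [v [hv vE]] := factor_part1 pg hh.
  exists v; split=> //; apply/lfunP => y; have [x <-] := eg y.
  by rewrite comp_lfunE vE uh comp_lfunE.
- by apply/epiP => y; have [x <-] := cover_epi cp y; exists (g x).
move=> U sU p1U; have [_ _ _ ess] := cp.
have gU : (g @^-1: (U : {vspace infl1 P1}))%VS = fullv.
  apply: ess; first by move=> a x; rewrite -!memv_preim hg; apply: sU.
  apply/vspaceP => y; rewrite memvf; have := memvf (y : L); rewrite -p1U.
  move=> /memv_imgP[z zU ->]; have [x gx] := eg z; apply/memv_imgP; exists x.
    by rewrite -memv_preim gx.
  by rewrite -p1E gx.
apply/vspaceP => y; rewrite memvf; have [x <-] := eg y.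
by have := memvf x; rewrite -gU -memv_preim.
Qed.

Lemma simple_infl2 (X : lmodule A2) : isSimple X <-> isSimple (infl2 X).
Proof.
split=> -[nX sX]; split=> // U sU; apply: sX => a x.
  exact: (sU (inj2 a)).
exact: (sU (tri22 a)).
Qed.

Lemma simple_infl1 (X : lmodule A1) : isSimple X <-> isSimple (infl1 X).
Proof.
split=> -[nX sX]; split=> // U sU; apply: sX => a x.
  exact: (sU (inj1 a)).
exact: (sU (tri11 a)).
Qed.

Lemma filt_infl2 C (C' : lmodule A -> Prop) (X : lmodule A2) :
  (forall Y, C Y -> C' (infl2 Y)) -> filt C X -> filt C' (infl2 X).
Proof.
move=> CC'; elim=> {X} [X X0 | X Y Z f g [hf hg mf eg ker] _ IH CZ].
  exact: filt0.
apply: (@filt_step _ _ C' (infl2 X) (infl2 Y) (infl2 Z) f g _ IH (CC' _ CZ)).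
by split=> //; apply/hom_infl2.
Qed.

Lemma filt_infl1 C (C' : lmodule A -> Prop) (X : lmodule A1) :
  (forall Y, C Y -> C' (infl1 Y)) -> filt C X -> filt C' (infl1 X).
Proof.
move=> CC'; elim=> {X} [X X0 | X Y Z f g [hf hg mf eg ker] _ IH CZ].
  exact: filt0.
apply: (@filt_step _ _ C' (infl1 X) (infl1 Y) (infl1 Z) f g _ IH (CC' _ CZ)).
by split=> //; apply/hom_infl1.
Qed.

Lemma endo_infl2 (X : lmodule A2) : endo_scalar X -> endo_scalar (infl2 X).
Proof. by move=> [nX scal]; split=> // f hf; apply: scal; apply/hom_infl2. Qed.

Lemma endo_infl1 (X : lmodule A1) : endo_scalar X -> endo_scalar (infl1 X).
Proof. by move=> [nX scal]; split=> // f hf; apply: scal; apply/hom_infl1. Qed.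

(* [P = A x] with [x = e1 x] is a direct summand of [A e1], whose [e2]-part is
   [M]. *)
Lemma part2_cover_retract P (L : lmodule A1) (p : 'Hom(P, infl1 L))
    (E : lmodule A2) (j : 'Hom(infl2 E, P)) :
  isSimple L -> isProjCover p -> is_part2 j ->
  exists (u : 'Hom(E, M)) (w : 'Hom(M, E)),
    [/\ isLHom u, isLHom w & forall x, w (u x) = x].
Proof.
move=> sL cp pj; have [hj mj jE] := pj; have hp := cover_hom cp.
have [l nl] := simple_neq0 sL; have [x0 px0] := cover_epi cp l.
(* [e1] acts as the identity on [infl1 L], so [x] still maps to [l]. *)
pose x : P := lact e1 x0.
have e1x : lact e1 x = x.
  by rewrite -lactM [e1 * e1]TriM linear0 bact0l mulr1 addr0 mulr0.
have px : p x = l by rewrite hp px0; apply: lact1.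
have ho := orbit_hom_hom x.
have epo : epi (p \o orbit_hom x)%VF.
  apply: simple_epi; [exact/simple_infl1 | exact: hom_comp | ].
  by apply/lfunPn; exists (1 : A); rewrite comp_lfunE orbit_homE lact1 px zero_lfunE.
have eo : epi (orbit_hom x).
  apply: (cover_essential cp ho) => y; have [z <-] := epo y.
  by exists z; rewrite comp_lfunE.
(* A section [h] of the orbit map of [x]. Its upper right entry gives [u]; acting on [x] by matrices
   with only that entry gives [w]. *)
have [h [hh hK]] := proj_lift (cover_proj cp) ho eo (@hom_id _ _ P).
have oh (y : P) : lact (h y : A) x = y by rewrite -orbit_homE hK id_lfunE.
pose u0 (y : E) : M := tri21 (h (j y)).
have u0_lin : linear u0.
  by move=> c y z; rewrite /u0 !linearP.
pose uL : {linear E -> M} := HB.pack u0 (GRing.isLinear.Build k E M *:%R u0 u0_lin).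
pose w0 (m : M) : P := lact (Tri 0 m 0 : A) x.
have w0_lin : linear w0.
  move=> c m n; rewrite /w0 -lactZl -lactDl; congr (lact _ x).
  by congr (_, _, _); rewrite /= ?scaler0 ?addr0.
pose wL : {linear (infl2 M : vectType k) -> P} :=
  HB.pack w0 (GRing.isLinear.Build k (infl2 M : vectType k) P *:%R w0 w0_lin).
have hw : isLHom (linfun wL : 'Hom(infl2 M, P)).
  move=> a m; rewrite !lfunE /= /w0 -lactM; congr (lact _ x).
  case: a => [[a n] b]; rewrite [RHS](TriM a n b 0 m 0).
  by rewrite bact0r !mulr0 addr0.
have [w [hw' wE]] := factor_part2 pj hw.
exists (linfun uL), w; split=> //.
  move=> a y; rewrite !lfunE /= /u0.
  have -> : j (lact a y) = lact (inj2 a) (j y) by rewrite -hj.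
  rewrite hh; case: (h _) => [[b m] c].
  by rewrite [lact _ _](TriM a 0 0 b m c) bact0l addr0.
move=> y; apply: (inj_of_mono mj); rewrite wE !lfunE /= /w0 /u0.
(* For [y] in the [e2]-part, [y = e2 h(y) x = (e2 h(y) e1) x], which involves only the upper right
   entry of [h(y)]. *)
by rewrite -e2_e1 lactM e1x lactM oh (hom_infl2_e2 _ hj).
Qed.

End Triangular.

(** * Simple and standard modules of the triangular ring *)

Section TriangularStandard.
Variables (k : fieldType) (A2 A1 : falgType k) (M : bimodule A2 A1).
Variables (I1 I2 : Type) (S1 : I1 -> lmodule A1) (S2 : I2 -> lmodule A2).
Variables (le1 : I1 -> I1 -> Prop) (le2 : I2 -> I2 -> Prop).
Hypotheses (sim1 : isSim S1) (sim2 : isSim S2).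
Notation A := (tri M).
Notation infl1 X := (lrestr (@tri11 k A2 A1 M) X).
Notation infl2 X := (lrestr (@tri22 k A2 A1 M) X).
Notation S := (triSim M S1 S2).
Notation le := (triLe le1 le2).
Implicit Types Z P Q : lmodule A.

Let simple1 i : isSimple (S1 i). Proof. by case: sim1. Qed.
Let simple2 i : isSimple (S2 i). Proof. by case: sim2. Qed.

Lemma simple_triSim i : isSimple (S i).
Proof. by case: i => i; [apply/(simple_infl1 M) | apply/(simple_infl2 M)]. Qed.

(** [e2] acts as the identity on modules inflated from [A2] and as zero on those from [A1], so the
    two kinds never meet. *)
Lemma triSim_iso i j : lmodule_iso (S i) (S j) -> i = j.
Proof.
have [_ inj1 _] := sim1; have [_ inj2 _] := sim2.
move: i j => [i|i] [j|j] [f [hf bf]].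
- by congr inl; apply: inj1; exists f; split=> //; apply/(hom_infl1 M)/hf.
- have [x nx] := simple_neq0 (simple1 i); have [mf _] := proj1 (bij_lfun f) bf.
  case/eqP: nx; apply: mf; rewrite -[LHS](@infl2_e2 _ _ _ M _ (f x)) -[LHS]hf.
  by rewrite [lact _ _](@infl1_e2 _ _ _ M _ x) linear0.
- have [x nx] := simple_neq0 (simple2 i); have [mf _] := proj1 (bij_lfun f) bf.
  case/eqP: nx; apply: mf; rewrite -(@infl2_e2 _ _ _ M _ x) hf; exact: infl1_e2.
by congr inr; apply: inj2; exists f; split=> //; apply/(hom_infl2 M)/hf.
Qed.

(** The submodule [e2 Z] of a simple module is zero or everything, so [Z] is inflated from [A1] or
    from [A2]. *)
Lemma triSim_full Z : isSimple Z -> exists i, lmodule_iso Z (S i).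
Proof.
move=> sZ; have [_ _ full1] := sim1; have [_ _ full2] := sim2.
have [Y [j [hj mj jE]]] := part2_exists Z.
have [X [g [hg eg gE]]] := part1_exists Z.
have [j0|nj] := eqVneq j 0.
  have mg : mono g.
    by move=> z /gE e2z; have /jE[y <-] := e2z; rewrite j0 zero_lfunE.
  have bg : bijective g by apply/bij_lfun.
  have sX : isSimple X.
    apply/(simple_infl1 M); have [z nz] := simple_neq0 sZ.
    have [h [hh _ hK]] := hom_inv hg mg eg.
    split=> [X0 | U sU].
      by case/eqP: nz; apply: mg; apply: zero_eq.
    have sgU : isSubmodule (g @^-1: U)%VS.
      by move=> a x; rewrite -!memv_preim hg; apply: sU.
    have [g0|gf] := sZ.2 _ sgU.
      left; apply/vspaceP => x; rewrite memv0; have [y <-] := eg x.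
      rewrite memv_preim g0 memv0.
      by apply/eqP/eqP => [->|/mg//]; rewrite linear0.
    right; apply/vspaceP => x; rewrite memvf; have [y <-] := eg x.
    by rewrite memv_preim gf memvf.
  have [i [f [hf bf]]] := full1 _ sX.
  exists (inl i), ((f : 'Hom(infl1 X, infl1 (S1 i))) \o g)%VF.
  split; first by apply: hom_comp => //; apply/(hom_infl1 M).
  apply/bij_lfun; have /bij_lfun[mf ef] := bf; split=> [z|y].
    by rewrite comp_lfunE => /mf/mg.
  by have [x <-] := ef y; have [z <-] := eg x; exists z; rewrite comp_lfunE.
have ej := simple_epi sZ hj nj.
have [h [hh hK jK]] := hom_inv hj mj ej.
have sY : isSimple Y.
  apply/(simple_infl2 M); have [z nz] := simple_neq0 sZ.
  split=> [Y0 | U sU].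
    by case/eqP: nz; rewrite -(jK z) (zero_eq (X := infl2 Y) (h z) Y0) linear0.
  have shU : isSubmodule (h @^-1: U)%VS.
    by move=> a x; rewrite -!memv_preim hh; apply: sU.
  have [h0|hf] := sZ.2 _ shU.
    left; apply/vspaceP => y; rewrite memv0 -{1}(hK y) memv_preim h0 memv0.
    by apply/eqP/eqP => [/mj|->]; rewrite ?linear0.
  right; apply/vspaceP => y; rewrite memvf -(hK y) memv_preim hf memvf.
  by [].
have [i [f [hf bf]]] := full2 _ sY.
exists (inr i), ((f : 'Hom(infl2 Y, infl2 (S2 i))) \o h)%VF.
split; first by apply: hom_comp => //; apply/(hom_infl2 M).
apply/bij_lfun; have /bij_lfun[mf ef] := bf; split=> [z|y].
  by rewrite comp_lfunE => /mf hz; rewrite -(jK z) hz linear0.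
by have [x <-] := ef y; exists (j x); rewrite comp_lfunE hK.
Qed.

Lemma isSim_tri : isSim S.
Proof.
by split; [exact: simple_triSim | exact: triSim_iso | exact: triSim_full].
Qed.

Lemma small_infl2 i (X : lmodule A2) : small S2 le2 i X -> small S le (inr i) (infl2 X).
Proof.
move=> sX [j|j] Q q f nji cq hf; first by case: nji.
have [Q2 [q2 cq2]] := simple_cover_exists (simple2 j).
have [h [hh bh _]] := cover_iso_id (cover_infl2 M cq2) cq.
have fh : (f \o h)%VF = 0.
  by apply: (sX j Q2 q2) => //; apply/(hom_infl2 M); apply: hom_comp.
apply/lfunP => x; have [y <-] := (proj1 (bij_lfun h) bh).2 x.
by rewrite -comp_lfunE fh !zero_lfunE.
Qed.

Lemma small_infl1 i (X : lmodule A1) : small S1 le1 i X -> small S le (inl i) (infl1 X).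
Proof.
move=> sX [j|j] Q q f nji cq hf.
  have [Q1 [g pg]] := part1_exists Q.
  have [q1 [cq1 q1E]] := cover_part1 cq pg.
  have [f1 [hf1 f1E]] := factor_part1 pg hf.
  apply/lfunP => x; rewrite -f1E (sX j Q1 q1 f1) //.
  by rewrite !zero_lfunE.
have [Q2 [q2 cq2]] := simple_cover_exists (simple2 j).
have [h [hh bh _]] := cover_iso_id (cover_infl2 M cq2) cq.
apply/lfunP => x; have [y <-] := (proj1 (bij_lfun h) bh).2 x.
by rewrite -(hom_infl2_e2 y hh) hf infl1_e2 zero_lfunE.
Qed.

(** A nonzero [e2]-part would have a simple quotient; its projective cover lifts to a nonzero map
    into [Z], although its label, coming from [A2], is not at most [inl i]. *)
Lemma small_inl_e2 i Z (z : Z) : small S le (inl i) Z -> lact (e2 M) z = 0.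
Proof.
move=> sZ; have [Y [j pj]] := part2_exists Z; have [hj mj jE] := pj.
suff Y0 : (fullv : {vspace Y}) = 0%VS.
  have /jE[y <-] : lact (e2 M) (lact (e2 M) z) = lact (e2 M) z by rewrite -lactM e2K.
  by rewrite (zero_eq (X := infl2 Y) y Y0) linear0.
apply/eqP/negPn/negP => /eqP/simple_quotient[L [g [sL hg eg]]].
have [_ _ /(_ L sL)[i2 [f [hf bf]]]] := sim2.
have [mf ef] := proj1 (bij_lfun f) bf.
have [Q [q cq]] := simple_cover_exists (simple2 i2).
have efg : epi (f \o g)%VF.
  by move=> y; have [x <-] := ef y; have [x' <-] := eg x; exists x'; rewrite comp_lfunE.
have [t [ht tE]] := proj_lift (cover_proj cq) (hom_comp hf hg) efg (cover_hom cq).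
have jt0 : (j \o (t : 'Hom(infl2 Q, infl2 Y)))%VF = 0.
  apply: (sZ (inr i2) (infl2 Q) q) => //; first exact: cover_infl2.
  by apply: hom_comp => //; apply/(hom_infl2 M).
have [y ny] := simple_neq0 (simple2 i2); have [x qx] := cover_epi cq y.
case/eqP: ny; rewrite -qx -tE (_ : t x = 0) ?linear0 //.
by apply: mj; rewrite -(comp_lfunE j) jt0 zero_lfunE.
Qed.

Lemma small_part1 i Z (X : lmodule A1) (g : 'Hom(Z, infl1 X)) :
  is_part1 g -> small S le (inl i) Z -> small S1 le1 i X /\ mono g.
Proof.
move=> pg sZ; have [hg eg gE] := pg.
have mg : mono g by move=> z /gE <-; apply: small_inl_e2 sZ.
split=> // j Q1 q1 f nji cq1 hf.
have [Q [q cq]] := simple_cover_exists (simple_triSim (inl j)).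
have [Q1' [r pr]] := part1_exists Q; have [hr er rE] := pr.
have [q1' [cq1' _]] := cover_part1 cq pr.
have [h [hh bh _]] := cover_iso_id cq1' cq1.
have [g' [hg' gK g'K]] := hom_inv hg mg eg.
have hfh : @isLHom _ A (infl1 Q1') (infl1 X) (f \o h)%VF.
  by apply/(hom_infl1 M); apply: hom_comp.
have fr0 := sZ (inl j) Q q _ nji cq (hom_comp hg' (hom_comp hfh hr)).
apply/lfunP => x; have [y <-] := (proj1 (bij_lfun h) bh).2 x.
have [z <-] := er y; have := congr1 (fun v : 'Hom(Q, Z) => g (v z)) fr0.
by rewrite /= comp_lfunE g'K !comp_lfunE !zero_lfunE linear0.
Qed.

Lemma standard_map_infl2 i (P X : lmodule A2) (d : 'Hom(P, X)) :
  standard_map S2 le2 i d -> @standard_map _ _ _ S le (inr i) (infl2 P) (infl2 X) d.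
Proof.
move=> [hd ed sX univ]; split=> //; [exact/(hom_infl2 M) | exact: small_infl2 |].
move=> Z f sZ hf x dx; have [Y [j pj]] := part2_exists Z.
have [f' [hf' f'E]] := factor_part2 pj hf.
rewrite -f'E (univ _ f') ?linear0 // => i2 Q q g nji cq hg.
have [hj mj _] := pj.
have /lfunP jg0 : (j \o (g : 'Hom(infl2 Q, infl2 Y)))%VF = 0.
  apply: (sZ (inr i2) (infl2 Q) q) => //; first exact: cover_infl2.
  by apply: hom_comp => //; apply/(hom_infl2 M).
apply/lfunP => y; apply: (inj_of_mono mj).
by have := jg0 y; rewrite comp_lfunE !zero_lfunE linear0.
Qed.

(** A module small for [inl i] has no [e2]-part, so a map from [P] to it factors through [P / e2 P]
    and the universal property over [A1] applies. *)
Lemma standard_map_part1 i P (P1 X : lmodule A1) (g : 'Hom(P, infl1 P1))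
    (d : 'Hom(P1, X)) : is_part1 g -> standard_map S1 le1 i d ->
  standard_map S le (inl i) ((d : 'Hom(infl1 P1, infl1 X)) \o g)%VF.
Proof.
move=> pg [hd ed sX univ]; have [hg eg gE] := pg; split.
- by apply: hom_comp => //; apply/(hom_infl1 M).
- by move=> y; have [x <-] := ed y; have [z <-] := eg x; exists z; rewrite comp_lfunE.
- exact: small_infl1.
move=> Z f sZ hf x; rewrite comp_lfunE => dgx.
have [Z1 [c pc]] := part1_exists Z; have [hc _ _] := pc.
have [sZ1 mc] := small_part1 pc sZ.
have [f' [hf' f'E]] := factor_part1 pg (hom_comp hc hf).
by apply: mc; rewrite -comp_lfunE -f'E (univ _ f').
Qed.

Lemma std_infl2 i X : std S2 le2 i X -> std S le (inr i) (infl2 X).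
Proof.
move=> [P [p [d [cp sd]]]]; exists (infl2 P), p, d.
by split; [exact: cover_infl2 | exact: standard_map_infl2].
Qed.

Lemma std_infl1 i X : std S1 le1 i X -> std S le (inl i) (infl1 X).
Proof.
move=> sX; have [P [p cp]] := simple_cover_exists (simple_triSim (inl i)).
have [P1 [g pg]] := part1_exists P; have [p1 [cp1 _]] := cover_part1 cp pg.
have [d sd] := std_cover sX cp1.
exists P, p, ((d : 'Hom(infl1 P1, infl1 X)) \o g)%VF.
by split=> //; apply: standard_map_part1.
Qed.

Lemma std_inl i Z : std S le (inl i) Z -> exists X (h : 'Hom(infl1 X, Z)),
  [/\ std S1 le1 i X, isLHom h & bijective h].
Proof.
move=> sZ; have [X sX] := std_exists le1 (simple1 i).
have [h [hh bh]] := std_unique (std_infl1 sX) sZ.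
by exists X, h.
Qed.

Lemma std_inr i Z : std S le (inr i) Z -> exists X (h : 'Hom(infl2 X, Z)),
  [/\ std S2 le2 i X, isLHom h & bijective h].
Proof.
move=> sZ; have [X sX] := std_exists le2 (simple2 i).
have [h [hh bh]] := std_unique (std_infl2 sX) sZ.
by exists X, h.
Qed.

Lemma order_triLe : Relation_Definitions.order I1 le1 ->
  Relation_Definitions.order I2 le2 -> Relation_Definitions.order (I1 + I2)%type le.
Proof.
move=> [r1 t1 a1] [r2 t2 a2]; split.
- by move=> [i|i] /=.
- by move=> [i|i] [j|j] [l|l] //=; [apply: t1 | apply: t2].
- by move=> [i|i] [j|j] //= ij ji; congr (_ _); [apply: a1 | apply: a2].
Qed.

End TriangularStandard.

Theorem quasiHereditary_tri (k : fieldType) (A2 A1 : falgType k)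
    (M : bimodule A2 A1) (I1 I2 : Type) (S1 : I1 -> lmodule A1)
    (S2 : I2 -> lmodule A2) (le1 : I1 -> I1 -> Prop) (le2 : I2 -> I2 -> Prop) :
  quasiHereditary S1 le1 -> quasiHereditary S2 le2 -> stdfilt S2 le2 M ->
  quasiHereditary (triSim M S1 S2) (triLe le1 le2).
Proof.
move=> qh1 qh2 fM; have [sim1 ord1 _ _] := qh1; have [sim2 ord2 _ _] := qh2.
have [simple1 _ _] := sim1; have [simple2 _ _] := sim2.
apply: qh_intro; [exact: isSim_tri | exact: order_triLe | |].
  move=> [i|i] Z sZ.
    have [X [h [sX hh bh]]] := std_inl sim1 sim2 sZ.
    by apply: endo_scalar_iso hh bh _; apply/endo_infl1/(qh_endo qh1 sX).
  have [X [h [sX hh bh]]] := std_inr sim2 sZ.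
  by apply: endo_scalar_iso hh bh _; apply/endo_infl2/(qh_endo qh2 sX).
move=> [i|i]; last first.
  have [P [p cp]] := simple_cover_exists (simple2 i).
  have [X [d sd]] := standard_map_exists S2 le2 i P.
  have [hd ed _ _] := sd; have [Y [f [hf mf ker]]] := kernel_exists hd.
  exists (lrestr (@tri22 _ _ _ M) P), p, (lrestr (@tri22 _ _ _ M) X), d.
  exists (lrestr (@tri22 _ _ _ M) Y), f; split.
  - exact: cover_infl2.
  - exact: standard_map_infl2.
  - by split=> //; apply/(hom_infl2 M).
  have fY : filt (above S2 le2 i) Y by apply: (qh_kernel (f := f) qh2 cp sd).
  apply: filt_infl2 fY => Z [j [leij nij sZ]]; exists (inr j).
  by split=> //; [case | exact: std_infl2].
have sS := simple_triSim M sim1 sim2 (inl i).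
have [P [p cp]] := simple_cover_exists sS.
have [P1 [g pg]] := part1_exists P; have [hg eg gE] := pg.
have [p1 [cp1 _]] := cover_part1 cp pg.
have [X [d sd]] := standard_map_exists S1 le1 i P1.
have [hd ed _ _] := sd; have [Y1 [f1 [hf1 mf1 ker1]]] := kernel_exists hd.
have fY1 : filt (above S1 le1 i) Y1 by apply: (qh_kernel (f := f1) qh1 cp1 sd).
have [E [j pj]] := part2_exists P; have [hj mj jE] := pj.
have [u [w [hu hw wu]]] := part2_cover_retract (simple1 i) cp pj.
have fE := stdfilt_retract qh2 fM hu hw wu.
pose I X := lrestr (@tri11 _ _ _ M) X.
pose dg := ((d : 'Hom(I P1, I X)) \o g)%VF.
have sdg : standard_map (triSim M S1 S2) (triLe le1 le2) (inl i) dg.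
  exact: standard_map_part1.
have [hdg edg _ _] := sdg.
have [Y [f [hf mf ker]]] := kernel_exists hdg.
exists P, p, (I X), dg, Y, f; split=> //.
(* [a] and [b] exhibit the kernel [Y] as an extension of [Y1], with labels above [i] in [I1], by
   [E], whose labels lie in [I2] and hence above [inl i]. *)
have [x|a [ha aE]] := factor_mono hf hj mf.
  apply/ker; rewrite comp_lfunE (_ : g (j x) = 0) ?linear0 //.
  by apply/gE; apply/jE; exists x.
have [y|b [hb bE]] := factor_mono (X := I Y1) (Z := I P1)
  (proj1 (hom_infl1 M f1) hf1) (hom_comp hg hf) mf1.
  apply/ker1; rewrite comp_lfunE -(comp_lfunE (d : 'Hom(I P1, I X))).
  by apply/ker; exists y.
have ab : ses a b.
  split=> //.
  - by move=> x ax; apply: mj; rewrite -aE ax linear0.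
  - move=> y1; have [z gz] := eg (f1 y1).
    have /ker[y fy] : dg z = 0 by rewrite comp_lfunE gz; apply/ker1; exists y1.
    by exists y; apply: (inj_of_mono mf1); rewrite bE comp_lfunE fy.
  move=> y; split=> [by0 | [x <-]].
    have /gE/jE[x jx] : g (f y) = 0 by rewrite -comp_lfunE -bE by0 linear0.
    by exists x; apply: (inj_of_mono mf); rewrite aE.
  apply: (inj_of_mono mf1); rewrite bE comp_lfunE aE linear0.
  by apply/gE/jE; exists x.
apply: filt_ext ab _ _.
  apply: filt_infl2 fE => Z [l sZ]; exists (inr l).
  by split=> //; exact: std_infl2.
apply: filt_infl1 fY1 => Z [l [leil nil sZ]]; exists (inl l).
by split=> //; [case | exact: std_infl1].
Qed.

(** * Tensor products and exact Borel subalgebras *)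

Lemma lfun_of_linear (k : fieldType) (V W : vectType k) (f : V -> W) :
  linear f -> exists F : 'Hom(V, W), forall x, F x = f x.
Proof.
move=> fl; pose L : {linear V -> W} := HB.pack f (GRing.isLinear.Build k V W *:%R f fl).
by exists (linfun L) => x; rewrite lfunE.
Qed.

Section Directed.
Variables (k : fieldType) (A : falgType k).
Variables (I : Type) (S : I -> lmodule A) (le : I -> I -> Prop).

(** Each simple module is its own standard module, so a composition series is a standard
    filtration. *)
Lemma directed_stdfilt (X : lmodule A) : directed S le -> stdfilt S le X.
Proof.
move=> [[[simpleS _ full] _ _ _] simpleD].
have std_S i : std S le i (S i).
  have [D sD] := std_exists le (simpleS i).
  have [P [p [d [cp [hd ed sDi ud]]]]] := sD.
  have simD : isSimple D by apply: simpleD; apply/isStandardP; exact: sD.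
  have [x nx] := simple_neq0 simD; have [y dy] := ed x.
  have [|f [hf fE]] := factor_epi hd (cover_hom cp) ed.
    have [K [u [hu _ ker]]] := kernel_exists hd.
    move=> z /ker[w <-]; rewrite -comp_lfunE.
    (* If the kernel of [d] mapped onto [S i], superfluity would make it all of [P], and the simple
       module [D] would vanish. So [p] factors through [d]. *)
    have [->|npu] := eqVneq (p \o u)%VF 0; first by rewrite zero_lfunE.
    have epu := simple_epi (simpleS i) (hom_comp (cover_hom cp) hu) npu.
    have [|w' uw'] := cover_essential cp hu _ y.
      by move=> s; have [v <-] := epu s; exists v; rewrite comp_lfunE.
    by case/eqP: nx; rewrite -dy; apply/ker; exists w'.
  have ef : epi f by move=> s; have [z <-] := cover_epi cp s; exists (d z).
  apply: (std_iso hf _ sD); apply/bij_lfun; split=> //.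
  apply: (simple_mono simD hf); have [s ns] := simple_neq0 (simpleS i).
  by apply/lfunPn; have [z fz] := ef s; exists z; rewrite fz zero_lfunE.
have [n] := ubnP (\dim {:X}); elim: n X => // n IH X ltXn.
have [X0|/eqP/simple_quotient[L [g [sL hg eg]]]] := eqVneq (fullv : {vspace X}) 0%VS.
  exact: filt0.
have [i [h [hh bh]]] := full _ sL; have [mh eh] := proj1 (bij_lfun h) bh.
have [K [f [hf mf ker]]] := kernel_exists hg.
have fg : ses f (h \o g)%VF.
  split=> //; first exact: hom_comp.
  - by move=> y; have [l <-] := eh y; have [x <-] := eg l; exists x; rewrite comp_lfunE.
  - by move=> x; rewrite comp_lfunE -ker; split=> [/mh//|->]; rewrite linear0.
apply: filt_step fg _ _; last by exists i; apply: std_S.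
apply: IH; apply: leq_trans _ (ltXn : (_ <= n)%N); rewrite ltnNge; apply/negP => leXK.
have [l nl] := simple_neq0 sL; have [x gx] := eg l.
have [y fy] := mono_epi mf leXK x.
by case/eqP: nl; rewrite -gx; apply/ker; exists y.
Qed.

End Directed.

HB.instance Definition _ (k : fieldType) (B : falgType k) (V : rmodule B) x :=
  GRing.isLinear.Build k B V *:%R (@ract k B V x) (@ract_linr k B V x).

(** * Dual bases of projective right modules *)

Section DualBasis.
Variables (k : fieldType) (B : falgType k).

Definition ractr (V : rmodule B) (b : B) (x : V) : V := ract x b.
HB.instance Definition _ (V : rmodule B) b :=
  GRing.isLinear.Build k V V *:%R (@ractr V b) (ract_linl b).

(** Any finite index type is allowed because the dual basis over the triangular ring is indexed by a
    sum type. *)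
Definition dual_basis (V : rmodule B) (I : finType) (v : I -> V)
    (phi : I -> V -> B) : Prop :=
  [/\ forall i, linear (phi i), forall i x b, phi i (ract x b) = phi i x * b
    & forall x, x = \sum_i ract (v i) (phi i x)].

Section Free.
Variable n : nat.
Let F := {ffun 'I_n -> B}.
Let act (f : F) (b : B) : F := [ffun i => f i * b].
Fact free_linl b : linear (act^~ b).
Proof.
by move=> c f g; apply/ffunP => i; rewrite !ffunE mulrDl scalerAl.
Qed.
Fact free_linr f : linear (act f).
Proof.
by move=> c a b; apply/ffunP => i; rewrite !ffunE mulrDr scalerAr.
Qed.
Fact free_act1 f : act f 1 = f.
Proof. by apply/ffunP => i; rewrite !ffunE mulr1. Qed.
Fact free_actM f a b : act f (a * b) = act (act f a) b.
Proof. by apply/ffunP => i; rewrite !ffunE mulrA. Qed.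
Definition free_rmodule : rmodule B :=
  RModule free_linl free_linr free_act1 free_actM.
End Free.

Lemma dual_basis_exists (V : rmodule B) : isRProjective V ->
  exists n (v : 'I_n -> V) (phi : 'I_n -> V -> B), dual_basis v phi.
Proof.
move=> pV; pose n := \dim {:V}; pose e := vbasis {:V}.
pose g0 (f : free_rmodule n) : V := \sum_(i < n) ract e`_i ((f : {ffun 'I_n -> B}) i).
have [|g gE] := @lfun_of_linear _ _ _ g0.
  move=> c f f'; rewrite /g0 scaler_sumr -big_split; apply: eq_bigr => i _.
  by rewrite !ffunE linearP.
have hg : isRHom g.
  move=> f b; rewrite !gE /g0 -[RHS]/(ractr b _) linear_sum; apply: eq_bigr => i _.
  by rewrite ffunE /ractr ractM.
have eg : limg g = fullv.
  (* A [k]-basis generates [V] over [B], already with scalar coefficients. *)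
  apply/epiP => x; exists ([ffun i => coord e i x *: 1] : {ffun 'I_n -> B}).
  rewrite gE /g0 [RHS](coord_vbasis (memvf x)); apply: eq_bigr => i _.
  by rewrite ffunE linearZ /= ract1.
have [|h [hh gh]] := pV _ _ g \1%VF hg eg; first by move=> x b; rewrite !id_lfunE.
exists n, (fun i => e`_i), (fun i x => (h x : {ffun 'I_n -> B}) i); split.
- by move=> i c x y; rewrite linearP /= !ffunE.
- by move=> i x b; rewrite hh ffunE.
by move=> x; have /lfunP/(_ x) := gh; rewrite comp_lfunE gE id_lfunE => {1}<-.
Qed.

Lemma dual_basis_proj (V : rmodule B) (I : finType) (v : I -> V)
    (phi : I -> V -> B) : dual_basis v phi -> isRProjective V.
Proof.
move=> [phil phiM vE] X Y g f hg /epiP eg hf.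
have [x gx] : exists x : I -> X, forall i, g (x i) = f (v i).
  exists (fun i => (g^-1)%VF (f (v i))) => i.
  by rewrite limg_lfunVK // (proj1 (epiP g) eg) memvf.
have [|h hE] := @lfun_of_linear _ _ _ (fun y : V => \sum_i ract (x i) (phi i y)).
  move=> c y z; rewrite scaler_sumr -big_split; apply: eq_bigr => i _.
  by rewrite phil linearP.
exists h; split.
  move=> y b; rewrite !hE -[RHS]/(ractr b _) linear_sum; apply: eq_bigr => i _.
  by rewrite phiM ractM.
apply/lfunP => y; rewrite comp_lfunE hE linear_sum [in RHS](vE y) linear_sum.
by apply: eq_bigr => i _; rewrite /= hg gx hf.
Qed.

End DualBasis.

Section TensorProducts.
Variables (k : fieldType) (B : falgType k) (V : rmodule B) (W : lmodule B).
Variables (T : vectType k) (t : V -> W -> T).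
Hypothesis tT : isTensor t.

Lemma tensor_ext (U : vectType k) (h h' : 'Hom(T, U)) :
  (forall v w, h (t v w) = h' (t v w)) -> h = h'.
Proof.
move=> hh'; have [[tl tr tb] univ] := tT.
have [|u [_ uE]] := univ U (fun v w => h' (t v w)).
  split=> [w c x y | v c x y | v b w].
  - by rewrite tl linearP.
  - by rewrite tr linearP.
  - by rewrite tb.
by rewrite -(uE h) // -(uE h').
Qed.

Lemma tensor_sum (J : finType) (v : J -> V) w :
  t (\sum_j v j) w = \sum_j t (v j) w.
Proof.
have [[tl _ _] _] := tT.
have [F FE] := lfun_of_linear (tl w).
by rewrite -FE linear_sum /=; apply: eq_bigr => j _; rewrite FE.
Qed.

(* [V] is a summand of a free module, so [V (x) W] embeds in a power of [W]. *)
Lemma tensor_coordinates n (v : 'I_n -> V) (phi : 'I_n -> V -> B) :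
  dual_basis v phi -> exists h : 'I_n -> 'Hom(T, W),
    (forall i x w, h i (t x w) = lact (phi i x) w)
    /\ forall y, y = \sum_i t (v i) (h i y).
Proof.
move=> [phil phiM vE]; have [[tl tr tb] univ] := tT.
have coordE i : exists h : 'Hom(T, W), forall x w, h (t x w) = lact (phi i x) w.
  have [|h [hE _]] := univ W (fun x w => lact (phi i x) w); last by exists h.
  split=> [w c x y | x c w w' | x b w].
  - by rewrite phil lactDl lactZl.
  - by rewrite linearP.
  - by rewrite phiM lactM.
have [h hE] := fin_all_exists coordE.
exists h; split=> // y.
have [|s sE] := @lfun_of_linear _ _ _ (fun y : T => \sum_i t (v i) (h i y)).
  move=> c y1 y2; rewrite scaler_sumr -big_split; apply: eq_bigr => i _.
  by rewrite linearP tr.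
rewrite -sE; have -> : s = \1%VF; last by rewrite id_lfunE.
apply: tensor_ext => x w; rewrite sE id_lfunE {2}(vE x) tensor_sum.
by apply: eq_bigr => i _; rewrite hE tb.
Qed.

End TensorProducts.

(* Faithful flatness of [A] over [B]: a simple [L] in the kernel of
   [N -> A (x) N] satisfies [A (x) L = 0], but [A (x) L] is standard. *)
Lemma induced_unit_inj (k : fieldType) (A B : falgType k)
    (f : {lrmorphism B -> A}) (I : Type) (S : I -> lmodule A)
    (le : I -> I -> Prop) (N : lmodule B) (X : lmodule A) (t : A -> N -> X) :
  exactBorel f S le -> isInduced f t -> forall x, t 1 x = 0 -> x = 0.
Proof.
move=> [qh _ pA [J [T [phi [_ ind [[[_ _ full] _ _ _] _]]]]]] [tT tA].
have [[tl tr tb] _] := tT.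
have t1b (b : B) x : t 1 (lact b x) = lact (f b) (t 1 x).
  by rewrite -tb -tA; congr t; rewrite /= mul1r mulr1.
have [F FE] := lfun_of_linear (tr 1).
suff K0 : lker F = 0%VS.
  by move=> x tx; apply/eqP; rewrite -memv0 -K0 memv_ker FE tx.
have sK : isSubmodule (lker F).
  by move=> b x; rewrite !memv_ker !FE t1b => /eqP->; rewrite linear0.
have [K [i [hi mi iK]]] := submodule_exists sK.
apply/eqP; rewrite -iK; have [->|/eqP] := eqVneq (fullv : {vspace K}) 0%VS.
  by rewrite limg0.
move=> /simple_submodule[L [l [sL hl ml]]]; exfalso.
have [j [u [hu bu]]] := full L sL; have [mu eu] := proj1 (bij_lfun u) bu.
have [u' [hu' uK u'K]] := hom_inv hu mu eu.
have [Y [tj [[tjT tjA] /isStandardP sY]]] := ind j.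
have [n [v [psi db]]] := dual_basis_exists pA.
have [psil psiM vE] := db; have [h [hE _]] := tensor_coordinates tT db.
(* Expanding [a] in the dual basis moves its coordinates onto [z]. Inside [N] the coordinate of [a]
   times [n] is [h] applied to [t a n = a (t 1 n)], which vanishes for [n] in the kernel. *)
have tj0 a z : tj a z = 0.
  rewrite (vE a) (tensor_sum tjT) big1 // => m _.
  have [[_ tjr tjb] _] := tjT; rewrite tjb.
  suff -> : lact (psi m a) z = 0.
    by have [G GE] := lfun_of_linear (tjr (v m)); rewrite -GE linear0.
  apply: (inj_mono (can_inj u'K)); apply/ml/mi.
  rewrite hu' hl hi -hE.
  suff -> : t a (i (l (u' z))) = 0 by rewrite linear0.
  rewrite -[a]mulr1 tA -FE.
  have : i (l (u' z)) \in lker F by rewrite -iK memv_img ?memvf.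
  by rewrite memv_ker => /eqP->; rewrite linear0.
have [[y ny] _] := qh_endo qh sY; case/eqP: ny.
have /lfunP/(_ y) : (\1%VF : 'End(Y)) = 0.
  by apply: (tensor_ext tjT) => a z; rewrite tj0 !linear0.
by rewrite id_lfunE zero_lfunE.
Qed.

Lemma simple_iso (k : fieldType) (A : falgType k) (X Y : lmodule A)
    (h : 'Hom(X, Y)) : isLHom h -> bijective h -> isSimple X -> isSimple Y.
Proof.
move=> hh /bij_lfun[mh eh] [nX sX]; split.
  move=> Y0; apply: nX; apply/vspaceP => x; rewrite memvf memv0.
  by apply/esym/eqP/mh/zero_eq.
move=> U sU; have sV : isSubmodule (h @^-1: U)%VS.
  by move=> a x; rewrite -!memv_preim hh; apply: sU.
have /epiP hT := eh.
have <- : (h @: (h @^-1: U))%VS = U by rewrite lpreimK // hT subvf.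
by have [->|->] := sX _ sV; [left; rewrite limg0 | right].
Qed.

Section DirectedTriangular.
Variables (k : fieldType) (B2 B1 : falgType k) (N : bimodule B2 B1).
Variables (J1 J2 : Type) (T1 : J1 -> lmodule B1) (T2 : J2 -> lmodule B2).
Variables (le1 : J1 -> J1 -> Prop) (le2 : J2 -> J2 -> Prop).

Lemma directed_tri : directed T1 le1 -> directed T2 le2 ->
  directed (triSim N T1 T2) (triLe le1 le2).
Proof.
move=> dir1 dir2; have [[sim1 _ _ _] simple1] := dir1.
have [[sim2 _ _ _] simple2] := dir2.
split.
  apply: quasiHereditary_tri; [exact: dir1.1 | exact: dir2.1 |].
  exact: directed_stdfilt.
move=> [j|j] X /isStandardP sX.
  have [Y [h [/isStandardP sY hh bh]]] := std_inl sim1 sim2 sX.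
  by apply: simple_iso hh bh _; apply/(simple_infl1 N); apply: simple1 sY.
have [Y [h [/isStandardP sY hh bh]]] := std_inr sim2 sX.
by apply: simple_iso hh bh _; apply/(simple_infl2 N); apply: simple2 sY.
Qed.

End DirectedTriangular.

(** An equality of relations, so that the order demanded by [exactBorel] can be rewritten into the
    form treated by [directed_tri]. *)
Lemma triLe_pullback (I1 I2 J1 J2 : Type) (le1 : I1 -> I1 -> Prop)
    (le2 : I2 -> I2 -> Prop) (phi1 : J1 -> I1) (phi2 : J2 -> I2) :
  let phi (j : J1 + J2) : I1 + I2 :=
    match j with inl j => inl (phi1 j) | inr j => inr (phi2 j) end in
  (fun j j' => triLe le1 le2 (phi j) (phi j')) =
  triLe (fun j j' => le1 (phi1 j) (phi1 j')) (fun j j' => le2 (phi2 j) (phi2 j')).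
Proof.
move=> phi; apply: functional_extensionality => j.
by apply: functional_extensionality => j'; case: j j' => [j|j] [j'|j'].
Qed.

Section TriangularMorphism.
Variables (k : fieldType) (A1 A2 B1 B2 : falgType k).
Variables (M : bimodule A2 A1) (N : bimodule B2 B1).
Variables (iota1 : {lrmorphism B1 -> A1}) (iota2 : {lrmorphism B2 -> A2}).

Lemma tri_eq (x y : tri M) : tri22 x = tri22 y -> tri21 x = tri21 y ->
  tri11 x = tri11 y -> x = y.
Proof.
by case: x y => [[a m] c] [[a' m'] c']; rewrite /tri22 /tri21 /tri11 /= => -> -> ->.
Qed.

Lemma tri22_sum (I : finType) (x : I -> tri M) :
  tri22 (\sum_i x i) = \sum_i tri22 (x i).
Proof. exact: (big_morph (@tri22 _ _ _ M)). Qed.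

Lemma tri21_sum (I : finType) (x : I -> tri M) :
  tri21 (\sum_i x i) = \sum_i tri21 (x i).
Proof. exact: (big_morph (@tri21 _ _ _ M)). Qed.

Lemma tri11_sum (I : finType) (x : I -> tri M) :
  tri11 (\sum_i x i) = \sum_i tri11 (x i).
Proof. exact: (big_morph (@tri11 _ _ _ M)). Qed.

Lemma tri_morphism (f : 'Hom(N, M)) :
  (forall b x, f (lact b x) = lact (iota2 b) (f x)) ->
  (forall x b, f (bact x b) = bact (f x) (iota1 b)) ->
  exists iota : {lrmorphism tri N -> tri M}, forall b2 x b1,
    iota (Tri b2 x b1) = Tri (iota2 b2) (f x) (iota1 b1).
Proof.
move=> fl fr.
pose g (x : tri N) : tri M := Tri (iota2 (tri22 x)) (f (tri21 x)) (iota1 (tri11 x)).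
have gl : linear g.
  by move=> c x y; apply: tri_eq; rewrite /g /tri22 /tri21 /tri11 /= linearP.
have gm : monoid_morphism g.
  split; first by apply: tri_eq; rewrite /g /tri22 /tri21 /tri11 /= ?rmorph1 ?linear0.
  move=> x y; apply: tri_eq; rewrite /g /tri22 /tri21 /tri11 /= ?rmorphM //.
  by rewrite linearD /= fl fr.
pose iota : {lrmorphism tri N -> tri M} :=
  HB.pack g (GRing.isLinear.Build k (tri N) (tri M) *:%R g gl)
    (GRing.isMonoidMorphism.Build (tri N) (tri M) g gm).
by exists iota.
Qed.

End TriangularMorphism.

(** * The triangular ring over its triangular subring *)

Section TriangularBorel.
Variables (k : fieldType) (A1 A2 B1 B2 : falgType k).
Variables (M : bimodule A2 A1) (N : bimodule B2 B1).
Variables (iota1 : {lrmorphism B1 -> A1}) (iota2 : {lrmorphism B2 -> A2}).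
Variables (T : bimodule A2 B1) (t : A2 -> N -> T).
Hypothesis tT : isInducedBimodule iota2 t.
Variable theta : 'Hom(T, brestr iota1 M).
Hypothesis thetaP : isBimodIso theta.
Variable iota : {lrmorphism tri N -> tri M}.
Hypothesis iotaE : forall b2 x b1,
  iota (Tri b2 x b1) = Tri (iota2 b2) (theta (t 1 x) : M) (iota1 b1).

Let tensT : isTensor (V := algr iota2) t. Proof. by case: tT => -[]. Qed.
Let tl w : linear (t^~ w). Proof. by case: tensT => -[]. Qed.
Let tr a : linear (t a). Proof. by case: tensT => -[]. Qed.
Let tA a a' x : t (a * a') x = lact a (t a' x). Proof. by case: tT => -[]. Qed.

Let t0 a : t a 0 = 0.
Proof. by have [F <-] := lfun_of_linear (tr a); rewrite linear0. Qed.

Let iota22 b : iota (Tri b 0 0) = Tri (iota2 b) 0 0.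
Proof. by rewrite iotaE t0 !linear0. Qed.

Let iota11 b : iota (Tri 0 0 b) = Tri 0 0 (iota1 b).
Proof. by rewrite iotaE t0 !linear0. Qed.

Lemma tri22_iota x : tri22 (iota x) = iota2 (tri22 x).
Proof. by case: x => [[a m] c]; rewrite iotaE. Qed.

Lemma tri11_iota x : tri11 (iota x) = iota1 (tri11 x).
Proof. by case: x => [[a m] c]; rewrite iotaE. Qed.

Lemma theta_pure a x : theta (t a x) = lact a (theta (t 1 x)).
Proof. by have [hth _ _] := thetaP; rewrite -hth -tA mulr1. Qed.

(** As a right module [A] is the sum of its rows: the upper row is [A2 (x) (B2 N)] over [B2], the
    lower one [A1 (x) B1] over [B1]. The coordinates [h] of [A2 (x) N] supply the entry in [N]. *)
Lemma tri_right_proj : isRProjective (algr iota1) -> isRProjective (algr iota2) ->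
  isRProjective (algr iota).
Proof.
move=> /dual_basis_exists[n1 [v1 [phi1 [phi1l phi1M v1E]]]].
move=> /dual_basis_exists[n2 [v2 [phi2 db2]]]; have [phi2l phi2M v2E] := db2.
have [h [hE hsum]] := tensor_coordinates tensT db2.
have [hth thb /bij_lfun[mth eth]] := thetaP.
have [th [hth' thK Kth]] := hom_inv hth mth eth.
(* The coordinates respect the right action of [B1]: both sides agree on pure tensors. *)
have hb i y c : h i (bact y c) = bact (h i y) c.
  have [R RE] := lfun_of_linear (@bact_linl _ _ _ T c).
  have [R' R'E] := lfun_of_linear (@bact_linl _ _ _ N c).
  rewrite -RE -R'E -!comp_lfunE; congr (fun_of_lfun _ y).
  apply: (tensor_ext tensT) => a x; rewrite !comp_lfunE RE R'E hE.
  by have [_ tB] := tT; rewrite -tB hE bactA.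
have thb' m c : th (bact m (iota1 c)) = bact (th m) c.
  by apply: (inj_of_mono mth); rewrite Kth thb Kth.
pose v (i : 'I_n2 + 'I_n1) : tri M :=
  match i with inl i => Tri (v2 i) 0 0 | inr i => Tri 0 0 (v1 i) end.
pose phi (i : 'I_n2 + 'I_n1) (x : tri M) : tri N :=
  match i with
  | inl i => Tri (phi2 i (tri22 x)) (h i (th (tri21 x))) 0
  | inr i => Tri 0 0 (phi1 i (tri11 x))
  end.
apply: (@dual_basis_proj _ _ (algr iota) _ v phi); split.
- move=> [i|i] c x y; apply: tri_eq; rewrite /tri22 /tri21 /tri11 /=.
  + exact: phi2l.
  + by rewrite !linearP.
  + by rewrite scaler0 addr0.
  + by rewrite scaler0 addr0.
  + by rewrite scaler0 addr0.
  + exact: phi1l.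
- move=> [i|i] [[a m] c] [[b2 x] b1]; rewrite /= iotaE; apply: tri_eq;
    rewrite /tri22 /tri21 /tri11 /=.
  + exact: phi2M.
  + rewrite linearD /= thb' hth' thK linearD /= hb; congr (_ + _).
    by rewrite -tA mulr1 hE.
  + by rewrite mul0r.
  + by rewrite mul0r.
  + by rewrite lact0l bact0l addr0.
  + exact: phi1M.
move=> x; rewrite big_sumType /=; case: x => [[a m] c].
have -> : \sum_i (v (inl i) : tri M) * iota (phi (inl i) (Tri a m c)) = Tri a m 0.
  apply: tri_eq; rewrite ?tri22_sum ?tri21_sum ?tri11_sum /tri22 /tri21 /tri11 /=.
  - by rewrite [RHS]v2E; apply: eq_bigr => i _; rewrite iotaE.
  - rewrite -[RHS]Kth [X in _ = theta X]hsum linear_sum /=; apply: eq_bigr => i _.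
    by rewrite iotaE [X in _ + X = _](bact0l _ _) addr0; apply/esym/theta_pure.
  by rewrite big1 // => i _; rewrite mul0r.
have -> : \sum_i (v (inr i) : tri M) * iota (phi (inr i) (Tri a m c)) = Tri 0 0 c.
  apply: tri_eq; rewrite ?tri22_sum ?tri21_sum ?tri11_sum /tri22 /tri21 /tri11 /=.
  - by rewrite big1 // => i _; rewrite mul0r.
  - by rewrite big1 // => i _; rewrite lact0l bact0l addr0.
  by rewrite [RHS]v1E; apply: eq_bigr => i _; rewrite iotaE.
by apply: tri_eq; rewrite /tri22 /tri21 /tri11 /= ?addr0 ?add0r.
Qed.

(** [Tri 1 0 0] acts as the identity on [L], so a balanced map depends on [z] only through its first
    column, that is through [tri22 z]. *)
Lemma induced_infl2 (L : lmodule B2) (X : lmodule A2) (s : A2 -> L -> X) :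
  isInduced iota2 s ->
  @isInduced _ _ _ iota (lrestr (@tri22 _ _ _ N) L) (lrestr (@tri22 _ _ _ M) X)
    (fun z => s (tri22 z)).
Proof.
move=> [[[sl sr sb] univ] sA]; split; last by move=> z z' l; apply: sA.
split.
  split=> [w c x y | z c x y | z b w]; [exact: sl | exact: sr |].
  by rewrite -[tri22 _]/(tri22 z * tri22 (iota b)) tri22_iota; apply: sb.
move=> U g [gl gr gb].
have gE z l : g z l = g (inj2 M (tri22 z)) l.
  have -> : inj2 M (tri22 z) = ract (z : algr iota) (Tri 1 0 0).
    rewrite /= iota22 rmorph1; case: z => [[a m] c]; rewrite [RHS](TriM a m c 1 0 0).
    by rewrite linear0 bact0r addr0 mulr0 mulr1.
  by rewrite gb; congr (g z _); apply/esym; apply: (@lact1 _ _ L).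
have [|h [hE uniq]] := univ U (fun a l => g (inj2 M a) l).
  split=> [w c a b | a c x y | a b w].
  - by rewrite inj2_lin gl.
  - exact: gr.
  - rewrite /= inj2M -[inj2 M (iota2 b)]iota22 gb.
    by congr (g _ _).
exists h; split=> [z l | h' h'E]; first by rewrite hE -gE.
by apply: uniq => a l; rewrite -h'E.
Qed.

(** [Tri 0 0 1] acts as the identity on [L], so only the second column of [z] matters; [gM] removes
    its entry in [M]. *)
Lemma induced_infl1 (L : lmodule B1) (X : lmodule A1) (s : A1 -> L -> X) :
  isInduced iota1 s ->
  @isInduced _ _ _ iota (lrestr (@tri11 _ _ _ N) L) (lrestr (@tri11 _ _ _ M) X)
    (fun z => s (tri11 z)).
Proof.
move=> [[[sl sr sb] univ] sA]; split; last by move=> z z' l; apply: sA.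
split.
  split=> [w c x y | z c x y | z b w]; [exact: sl | exact: sr |].
  by rewrite -[tri11 _]/(tri11 z * tri11 (iota b)) tri11_iota; apply: sb.
move=> U g [gl gr gb]; have [hth thb /bij_lfun[mth eth]] := thetaP.
have gM m l : g (Tri 0 m 0) l = 0.
  have [y <-] := eth m.
  have [|G GE] := @lfun_of_linear _ _ _ (fun y : T => g (Tri 0 (theta y : M) 0) l).
    move=> c y1 y2; rewrite -gl; congr (g _ l).
    by apply: tri_eq; rewrite /tri22 /tri21 /tri11 /= ?linearP ?scaler0 ?addr0.
  rewrite -(GE y); have -> : G = 0; last by rewrite zero_lfunE.
  (* On a pure tensor the entry is [Tri a 0 0] times the image of [Tri 0 x 0]; balancing moves the
     latter onto [l], which it kills. *)
  apply: (tensor_ext tensT) => a x; rewrite GE zero_lfunE theta_pure.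
  have -> : Tri 0 (lact a (theta (t 1 x) : M)) 0 =
      (Tri a 0 0 : tri M) * iota (Tri 0 x 0).
    by rewrite iotaE [RHS](TriM a 0 0 _ _ _) !linear0 bact0l addr0 !mulr0.
  rewrite -[_ * iota _]/(ract (Tri a 0 0 : algr iota) (Tri 0 x 0)) gb.
  have [F <-] := lfun_of_linear (gr (Tri a 0 0)).
  by rewrite (_ : lact _ l = 0) ?linear0 //; apply: lact0l.
have gE z l : g z l = g (inj1 M (tri11 z)) l.
  have e1l : lact (Tri 0 0 1 : tri N) l = l by apply: (@lact1 _ _ L).
  have -> : g z l = g (ract (z : algr iota) (Tri 0 0 1)) l by rewrite gb e1l.
  have [F FE] := lfun_of_linear (gl l).
  rewrite /= iota11 rmorph1; case: z => [[a m] c]; rewrite (TriM a m c 0 0 1).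
  rewrite linear0 bact1 add0r !mulr0 mulr1.
  have -> : Tri 0 m c = Tri 0 m 0 + inj1 M c.
    by apply: tri_eq; rewrite /tri22 /tri21 /tri11 /= ?addr0 ?add0r.
  by rewrite -!FE linearD /= FE gM add0r.
have [|h [hE uniq]] := univ U (fun a l => g (inj1 M a) l).
  split=> [w c a b | a c x y | a b w].
  - by rewrite inj1_lin gl.
  - exact: gr.
  - rewrite /= inj1M -[inj1 M (iota1 b)]iota11 gb.
    by congr (g _ _).
exists h; split=> [z l | h' h'E]; first by rewrite hE -gE.
by apply: uniq => a l; rewrite -h'E.
Qed.

End TriangularBorel.

Theorem proposition4p11 (k : closedFieldType) (A1 A2 : falgType k)
    (I1 I2 : Type) (S1 : I1 -> lmodule A1) (S2 : I2 -> lmodule A2)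
    (le1 : I1 -> I1 -> Prop) (le2 : I2 -> I2 -> Prop)
    (qh1 : quasiHereditary S1 le1) (qh2 : quasiHereditary S2 le2)
    (M : bimodule A2 A1) (filM : standardlyFiltered S2 le2 M)
    (B1 B2 : falgType k)
    (iota1 : {lrmorphism B1 -> A1}) (iota2 : {lrmorphism B2 -> A2})
    (borel1 : exactBorel iota1 S1 le1) (borel2 : exactBorel iota2 S2 le2)
    (N : bimodule B2 B1)
    (T : bimodule A2 B1) (t : A2 -> N -> T) (tT : isInducedBimodule iota2 t)
    (theta : 'Hom(T, brestr iota1 M)) (thetaP : isBimodIso theta) :
  exists iota : {lrmorphism tri N -> tri M},
    (forall (b2 : B2) (x : N) (b1 : B1),
       iota (Tri b2 x b1) = Tri (iota2 b2) (theta (t 1 x) : M) (iota1 b1))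
    /\ exactBorel iota (triSim M S1 S2) (triLe le1 le2).
Proof.
have [_ inj1 proj1 [J1 [T1 [phi1 [bphi1 ind1 dir1]]]]] := borel1.
have [_ inj2 proj2 [J2 [T2 [phi2 [bphi2 ind2 dir2]]]]] := borel2.
have [hth thb bth] := thetaP; have [[[[tl tr tb] _] tA] tB] := tT.
have [f fE] : exists f : 'Hom(N, M), forall x, f x = theta (t 1 x).
  apply: (@lfun_of_linear _ _ _ (fun x => theta (t 1 x) : M)).
  by move=> c x y; rewrite tr linearP.
have [||iota iotaE] := @tri_morphism _ _ _ _ _ M N iota1 iota2 f.
- by move=> b x; rewrite !fE -tb -hth -tA /= mul1r mulr1.
- by move=> x b; rewrite !fE tB thb.
have iotaE' b2 x b1 :
    iota (Tri b2 x b1) = Tri (iota2 b2) (theta (t 1 x) : M) (iota1 b1).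
  by rewrite iotaE fE.
have [sim1 _ _ _] := qh1; have [sim2 _ _ _] := qh2.
have fM : stdfilt S2 le2 M.
  have /filteredBy_full := filM.
  by apply: filtW => Z [i /isStandardP sZ]; exists i.
exists iota; split=> //; split.
- exact: quasiHereditary_tri.
- move=> [[a m] c] [[a' m'] c'].
  rewrite [LHS](iotaE' a m c) [RHS](iotaE' a' m' c').
  move=> -[/inj2-> /(bij_inj bth) tmm /inj1->].
  congr (_, _, _); apply/eqP; rewrite -subr_eq0; apply/eqP.
  (* For the upper right entry, injectivity of [theta] leaves that of [x |-> 1 (x) x]. *)
  apply: (induced_unit_inj borel2 tT.1).
  have [F FE] := lfun_of_linear (tr 1).
  by rewrite -FE linearB /= !FE tmm subrr.
- exact: (tri_right_proj tT thetaP iotaE').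
pose phi (j : J1 + J2) : I1 + I2 :=
  match j with inl j => inl (phi1 j) | inr j => inr (phi2 j) end.
exists (J1 + J2)%type, (triSim N T1 T2), phi; split.
- have [psi1 psiK1 Kpsi1] := bphi1; have [psi2 psiK2 Kpsi2] := bphi2.
  exists (fun i => match i with inl i => inl (psi1 i) | inr i => inr (psi2 i) end).
    by move=> [j|j]; rewrite /= ?psiK1 ?psiK2.
  by move=> [j|j]; rewrite /= ?Kpsi1 ?Kpsi2.
- move=> [j|j].
    have [X [s [sX /isStandardP stX]]] := ind1 j.
    exists (lrestr (@tri11 _ _ _ M) X), (fun z => s (tri11 z)).
    split; first exact: (induced_infl1 tT thetaP iotaE').
    exact/isStandardP/std_infl1.
  have [X [s [sX /isStandardP stX]]] := ind2 j.
  exists (lrestr (@tri22 _ _ _ M) X), (fun z => s (tri22 z)).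
  split; first exact: (induced_infl2 tT iotaE').
  exact/isStandardP/std_infl2.
by rewrite triLe_pullback; apply: directed_tri.
Qed.
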